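(* Let $k\ge 2$, let $\pi\in S_k$ and $A\subseteq\{1,\dots,k-1\}$, so that $(\pi,A)$ is a fixed vincular pattern. For each $n\ge k$ let $\sigma_n$ be a uniformly random element of $S_n$, let $X^{(\pi,A)}(\sigma_n)$ be the number of occurrences of $(\pi,A)$ in $\sigma_n$, and let $$\overline{X^{(\pi,A)}(\sigma_n)}=\frac{X^{(\pi,A)}(\sigma_n)-\mathbb{E}[X^{(\pi,A)}(\sigma_n)]}{\sqrt{\operatorname{Var}(X^{(\pi,A)}(\sigma_n))}}.$$ Let $Z$ be a standard normal random variable. Then there exist a constant $C>0$ and an integer $n_0$ (depending only on $(\pi,A)$) such that for all $n\ge n_0$, $$d_K\Bigl(\overline{X^{(\pi,A)}(\sigma_n)},Z\Bigr)\le C\,n^{-1/2}.$$ Consequently, $\overline{X^{(\pi,A)}(\sigma_n)}$ converges in distribution to $Z$ as $n\to\infty$.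
   Context: $S_n$ is the set of permutations of $\{1,\dots,n\}$, written in one-line notation $\sigma=\sigma_1\sigma_2\dots\sigma_n$. A vincular pattern of size $k$ is a pair $(\pi,A)$ with $\pi\in S_k$ and $A\subseteq\{1,\dots,k-1\}$. An occurrence of $(\pi,A)$ in $\sigma\in S_n$ is a subsequence $\sigma_{i_1}\sigma_{i_2}\dots\sigma_{i_k}$ with $i_1<i_2<\dots<i_k$ (identified with its set of positions $\{i_1,\dots,i_k\}$) such that (i) for all $r,s\in\{1,\dots,k\}$, $\pi_r<\pi_s \iff \sigma_{i_r}<\sigma_{i_s}$; and (ii) $i_{a+1}=i_a+1$ for all $a\in A$. For $n\ge k\ge 2$ the variance of $X^{(\pi,A)}(\sigma_n)$ is positive, so the normalization is well defined. The Kolmogorov distance between real random variables $X$ and $Y$ with distribution functions $F_X,F_Y$ is $d_K(X,Y)=\sup_{t\in\mathbb{R}}|F_X(t)-F_Y(t)|$. *)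

(* Defs.v *)
From HB Require Import structures.
From mathcomp Require Import all_boot all_order all_algebra perm.
From mathcomp Require Import all_classical all_reals all_analysis.
From mathcomp Require Import measurable_realfun.

Set Implicit Arguments.
Unset Strict Implicit.
Unset Printing Implicit Defensive.

Import Order.TTheory GRing.Theory Num.Theory.
Import numFieldNormedType.Exports.

Local Open Scope classical_set_scope.
Local Open Scope ring_scope.

(* The sigma-algebra on the finite set of permutations is the power set; the
   instances are attached to perm_type, to which {perm T} unfolds. *)
HB.instance Definition _ (T : finType) :=
  isPointed.Build (perm_type T) (1%g : {perm T}).

HB.instance Definition _ (T : finType) :=
  @isMeasurable.Build default_measure_display (perm_type T)
    discrete_measurable discrete_measurable0
    discrete_measurableC discrete_measurableU.

(* Positions and values are numbered from 0, and a vincular pattern of size k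
   is given by pi : 'S_k and A : {set 'I_k.-1}; the index a : 'I_k.-1 stands
   for the element a + 1 of {1, ..., k - 1}, so that a \in A forces the
   positions with 0-based indices a and a.+1 to be adjacent.
   An occurrence is encoded by the increasing sequence i of its positions. *)
Definition is_occurrence (k n : nat) (pi : 'S_k) (A : {set 'I_k.-1})
    (s : 'S_n) (i : {ffun 'I_k -> 'I_n}) : bool :=
  [&& [forall r : 'I_k, forall t : 'I_k, (r < t)%N ==> (i r < i t)%N],
      [forall r : 'I_k, forall t : 'I_k,
         (pi r < pi t)%N == (s (i r) < s (i t))%N]
    & [forall a in A, forall r : 'I_k, forall t : 'I_k,
         (r == a :> nat) && (t == a.+1 :> nat) ==>
           (i t == (i r).+1 :> nat)]].

Definition occurrences (k n : nat) (pi : 'S_k) (A : {set 'I_k.-1})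
    (s : 'S_n) : nat :=
  #|[pred i : {ffun 'I_k -> 'I_n} | is_occurrence pi A s i]|.

Definition occ_count (R : realType) (k n : nat) (pi : 'S_k)
    (A : {set 'I_k.-1}) (s : 'S_n) : R := (occurrences pi A s)%:R.

Lemma measurable_occ_count (R : realType) (k n : nat) (pi : 'S_k)
    (A : {set 'I_k.-1}) :
  measurable_fun [set: 'S_n] (@occ_count R k n pi A).
Proof. by []. Qed.

HB.instance Definition _ (R : realType) (k n : nat) (pi : 'S_k)
    (A : {set 'I_k.-1}) :=
  isMeasurableFun.Build _ _ _ _ (@occ_count R k n pi A)
    (@measurable_occ_count R k n pi A).

Definition occ_rv (R : realType) (k n : nat) (pi : 'S_k) (A : {set 'I_k.-1})
    (d : measure_display) (T : measurableType d) (P : probability T R)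
    (sigma : {RV P >-> 'S_n}) : {RV P >-> R} :=
  @occ_count R k n pi A \o sigma.

Definition uniform_perm (R : realType) (n : nat) (d : measure_display)
    (T : measurableType d) (P : probability T R) (sigma : {RV P >-> 'S_n}) :
    Prop :=
  forall s : 'S_n, distribution P sigma [set s] = ((n`!)%:R^-1)%:E.

(* Meaningful when X has a finite mean and a finite positive variance. *)
Definition standardize (R : realType) (d : measure_display)
    (T : measurableType d) (P : probability T R) (X : {RV P >-> R}) : T -> R :=
  fun w => (X w - fine 'E_P[X]) / Num.sqrt (fine 'V_P[X]).

Lemma measurable_standardize (R : realType) (d : measure_display)
    (T : measurableType d) (P : probability T R) (X : {RV P >-> R}) :
  measurable_fun [set: T] (standardize X).
Proof.
apply: measurable_funM; last exact: measurable_cst.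
by apply: measurable_funB; [exact: measurable_funPT | exact: measurable_cst].
Qed.

HB.instance Definition _ (R : realType) (d : measure_display)
    (T : measurableType d) (P : probability T R) (X : {RV P >-> R}) :=
  isMeasurableFun.Build _ _ _ _ (standardize X) (measurable_standardize X).

Definition standardized_rv (R : realType) (d : measure_display)
    (T : measurableType d) (P : probability T R) (X : {RV P >-> R}) :
  {RV P >-> R} := standardize X.

Definition standard_normal (R : realType) (d : measure_display)
    (T : measurableType d) (P : probability T R) (Z : {RV P >-> R}) : Prop :=
  forall U : set R, measurable U -> distribution P Z U = normal_prob 0 1 U.

Definition kolmogorov_dist (R : realType) (d1 d2 : measure_display)
    (T1 : measurableType d1) (T2 : measurableType d2)
    (P1 : probability T1 R) (P2 : probability T2 R)
    (X : {RV P1 >-> R}) (Y : {RV P2 >-> R}) : \bar R :=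
  ereal_sup (range (fun t : R => `|cdf X t - cdf Y t|%E)).

Definition cvg_in_distribution (R : realType) (d : nat -> measure_display)
    (d' : measure_display) (T : forall n, measurableType (d n))
    (T' : measurableType d') (P : forall n, probability (T n) R)
    (P' : probability T' R) (X : forall n, {RV (P n) >-> R})
    (Y : {RV P' >-> R}) : Prop :=
  forall t : R, {for t, continuous (cdf Y)} ->
    cdf (X n) t @[n --> \oo] --> cdf Y t.

(* Main.v *)
(** Write the number of occurrences as a sum of indicators [X_I] over the
    admissible position vectors [I].  With [j] blocks of adjacent positions there
    are at most [n^j] of them, and each meets at most [k^2 n^(j-1)] others.  Since
    [X_I] depends only on the relative order of the values on [I], averaging over
    the permutations of the positions in [I] shows that it is independent of every
    function of the values off [I].  Stein's method for this local dependence,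
    applied to a piecewise linear smoothing of an indicator, bounds the Kolmogorov
    distance [Delta] by [Delta / 4 + O(n^(-1/2))] as soon as
    [Var X >= c n^(2 j - 1)].

    The variance bound comes from Cauchy-Schwarz against a test statistic.  For
    [j >= 2] it counts the top values on a short end segment of positions, the end
    being chosen so that the maximum of [pi] is not in the extreme block there: an
    occurrence with its extreme entry in the segment makes a top value at that
    entry unlikely, and the covariance is negative of order [n^j].  For [j = 1] it
    is a sum over disjoint windows of orthogonal local terms, the difference
    between [X] and its mean under permutations of [k] consecutive positions. *)

Require Import Defs.
From HB Require Import structures.
From mathcomp Require Import all_boot all_order all_algebra perm.
From mathcomp Require Import all_classical all_reals all_analysis.
From mathcomp Require Import measurable_realfun.
From mathcomp Require Import ring lra zify.

Set Implicit Arguments.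
Unset Strict Implicit.
Unset Printing Implicit Defensive.

Import Order.TTheory GRing.Theory Num.Theory.
Import numFieldNormedType.Exports.

Local Open Scope classical_set_scope.
Local Open Scope ring_scope.

(** With [j] blocks there are at most [n^j] terms, a neighbourhood has size of order [n^(j-1)], and
    the standard deviation is at least of order [n^(j-1/2)]; the three Stein errors [N D^2 / sg^3],
    [D / sg] and [sqrt (N D^3) / sg^2] are then all of order [n^(-1/2)]. The distance [Delta] recurs
    in its own bound because the slope [1 / e] of a ramp of width [e] is felt only while the
    normalized sum lies near the ramp, an event whose probability is known only up to [Delta]. For
    the variance with [j >= 2], an end segment of [m] positions contains the extreme entry of about
    [m n^(j-1)] vectors, but it also contains an entry from another block for only about
    [m^2 n^(j-2)] of them, and a small fixed ratio [m / n] makes the first count dominate. With a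
    single block the maximum stays within distance [k] of the extreme entry, the two counts are
    comparable and the sign of the covariance is lost; hence the different statistic for [j = 1]. *)

(** * Consequences of the mean value theorem *)

Lemma is_derive_continuous (R : realType) (f : R -> R) (x d : R) :
  is_derive x 1 f d -> {for x, continuous f}.
Proof.
by move=> fd; apply/differentiable_continuous/derivable1_diffP/(@ex_derive _ _ _ _ _ _ _ fd).
Qed.

Lemma MVT_eq (R : realType) (f df : R -> R) (a b : R) :
  (forall x : R, is_derive x 1 f (df x)) -> a <= b ->
  exists2 c, a <= c <= b & f b - f a = df c * (b - a).
Proof.
move=> fd ab.
have cf : {within `[a, b], continuous f}.
  by apply: continuous_subspaceT => x; apply: is_derive_continuous (fd x).
have [c] := MVT_segment ab (fun x _ => fd x) cf.
by rewrite in_itv /= => cab fE; exists c.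
Qed.

Lemma derive_nondecreasing (R : realType) (f df : R -> R) (a b : R) :
  (forall x : R, a <= x -> is_derive x 1 f (df x)) ->
  (forall x, a <= x -> 0 <= df x) -> a <= b -> f a <= f b.
Proof.
move=> fd df0 ab.
have fd' x : x \in `]a, b[ -> is_derive x 1 f (df x).
  by rewrite in_itv /= => /andP[/ltW ax _]; exact: fd.
have cf : {within `[a, b], continuous f}.
  apply: continuous_in_subspaceT => x; rewrite inE /= in_itv /= => /andP[ax _].
  exact: is_derive_continuous (fd x ax).
have [c] := MVT_segment ab fd' cf.
rewrite in_itv /= => /andP[ac cb] fE.
by rewrite -subr_ge0 fE mulr_ge0 ?df0 // subr_ge0.
Qed.

(** * Stein's equation for the normal law *)

Section Gauss.
Variable R : realType.
Local Notation phi := (normal_pdf (0 : R) 1).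

Lemma normal_pdf01E (x : R) : phi x = normal_peak 1 * expR (- (x ^+ 2 / 2)).
Proof.
by rewrite normal_pdfE ?oner_eq0 // /normal_fun subr0 expr1n mulNr.
Qed.

Lemma normal_pdf01_gt0 (x : R) : 0 < phi x.
Proof. by rewrite normal_pdf01E mulr_gt0 ?expR_gt0 // normal_peak_gt0 // oner_eq0. Qed.

Lemma normal_pdf01_le1 (x : R) : phi x <= 1.
Proof.
apply: (le_trans (normal_pdf_ub _ _ (oner_neq0 R))).
rewrite /normal_peak invf_le1; last first.
  by rewrite sqrtr_gt0 expr1n mul1r mulrn_wgt0 ?pi_gt0.
rewrite -[leLHS]sqrtr1 ler_wsqrtr // expr1n mul1r.
by have := pi_ge2 R; rewrite mulr2n; lra.
Qed.

Lemma normal_pdf01N (x : R) : phi (- x) = phi x.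
Proof. by rewrite !normal_pdf01E sqrrN. Qed.

Lemma is_derive_normal_pdf01 (x : R) : is_derive x 1 (phi : R -> R) (- x * phi x).
Proof.
have -> : (phi : R -> R) = (fun x => normal_peak 1 * expR (- (x ^+ 2 / 2))).
  by apply/funext => y; rewrite normal_pdf01E.
apply: is_derive_eq.
by rewrite /GRing.scale /=; field.
Qed.

(* On [x >= 0] the derivative of [2 phi x / (1 + x)] is at most [- phi x], because
   [2 (x^2 + x + 1) >= (1 + x)^2]. *)
Lemma gauss_tail_le (K k : R -> R) :
  (forall x : R, is_derive x 1 K (k x)) ->
  (forall x, `|k x| <= phi x) ->
  (forall e x, 0 < e -> exists2 y, x <= y & `|K y| < e) ->
  forall w, 0 <= w -> K w <= 2 * phi w / (1 + w).
Proof.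
move=> Kd kphi K0 w w0; rewrite leNgt; apply/negP => Mw.
set M := (fun x : R => 2 * phi x / (1 + x)) in Mw *.
pose dM x := - (2 * x * phi x / (1 + x) + 2 * phi x / (1 + x) ^+ 2).
have Md (x : R) : w <= x -> is_derive x 1 M (dM x).
  move=> wx; have x1 : 1 + x != 0 by rewrite gt_eqF //; lra.
  have Vd : is_derive x 1 (fun y : R => (1 + y)^-1) (- (1 + x) ^- 2 *: 1).
    apply: is_deriveV => //.
    by apply: is_derive_eq; rewrite add0r.
  have Pd := is_derive_normal_pdf01 x.
  apply: is_derive_eq.
  by rewrite /dM /GRing.scale /=; field.
(* [K - M] is nondecreasing on [[w, +oo[] and [M >= 0], so [K] would stay above the positive gap
   [K w - M w], against its smallness far out. *)
have [y wy] := K0 (K w - M w) w ltac:(by rewrite subr_gt0).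
rewrite ltr_norml => /andP[_ Ky].
suff : K w - M w <= K y - M y.
  have : 0 <= M y.
    by rewrite /M divr_ge0 ?mulr_ge0 ?(ltW (normal_pdf01_gt0 _)) //; lra.
  by lra.
apply: (@derive_nondecreasing _ (fun x => K x - M x) (fun x => k x - dM x) w _ _ _ wy).
  by move=> x wx; have := Md x wx => Mdx; apply: is_derive_eq.
move=> x wx; rewrite /dM opprK.
have := kphi x; rewrite ler_norml => /andP[kx _].
have px := normal_pdf01_gt0 x.
have x1 : 1 + x != 0 by rewrite gt_eqF //; lra.
suff : 0 <= - phi x + (2 * x * phi x / (1 + x) + 2 * phi x / (1 + x) ^+ 2) by lra.
have -> : - phi x + (2 * x * phi x / (1 + x) + 2 * phi x / (1 + x) ^+ 2) =
  phi x * (x ^+ 2 + 1) / (1 + x) ^+ 2 by field.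
by rewrite divr_ge0 ?sqr_ge0 // mulr_ge0 ?(ltW px) // addr_ge0 ?sqr_ge0.
Qed.

Lemma gauss_tail_abs (K k : R -> R) :
  (forall x : R, is_derive x 1 K (k x)) ->
  (forall x, `|k x| <= phi x) ->
  (forall e x, 0 < e -> exists2 y, x <= y & `|K y| < e) ->
  forall w, 0 <= w -> `|K w| <= 2 * phi w / (1 + w).
Proof.
move=> Kd kphi K0 w w0; rewrite ler_norml lerNl; apply/andP; split; last first.
  exact: (gauss_tail_le Kd).
apply: (@gauss_tail_le (fun x => - K x) (fun x => - k x)) => //.
- by move=> x; rewrite normrN.
- by move=> e x /K0 - /(_ x)[y xy Ky]; exists y => //; rewrite normrN.
Qed.

(** The left half follows from the right half by the reflection [x -> - x]. The decay in [1 + |w|]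
    is what later keeps [x * f x] bounded for [f = K / phi]. *)
Lemma gauss_tail (K k : R -> R) :
  (forall x : R, is_derive x 1 K (k x)) ->
  (forall x, `|k x| <= phi x) ->
  (forall e x, 0 < e -> exists2 y, x <= y & `|K y| < e) ->
  (forall e x, 0 < e -> exists2 y, y <= x & `|K y| < e) ->
  forall w, `|K w| <= 2 * phi w / (1 + `|w|).
Proof.
move=> Kd kphi Ky KNy w; have [w0|/ltW w0] := leP 0 w.
  by rewrite (ger0_norm w0); exact: (gauss_tail_abs Kd).
rewrite (ler0_norm w0) -normal_pdf01N.
have := @gauss_tail_abs (fun x => K (- x)) (fun x => - k (- x)) _ _ _ (- w).
rewrite opprK; apply; rewrite ?oppr_ge0 //.
- move=> x.
  have Kx := Kd (- x).
  by apply: is_derive_eq; rewrite /GRing.scale /= mulrN1.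
- by move=> x; rewrite normrN -normal_pdf01N.
- move=> e x e0; have [y yx Kye] := KNy e (- x) e0.
  by exists (- y); [rewrite lerNr | rewrite opprK].
Qed.

End Gauss.

Section GaussInt.
Variable R : realType.
Local Notation phi := (normal_pdf (0 : R) 1).
Local Notation mu := (@lebesgue_measure R).

Definition normal_cdf (x : R) : R := \int[mu]_(t in `]-oo, x]) phi t.

Lemma integrable_mul_normal_pdf (g : R -> R) (D : set R) :
  measurable D -> continuous g -> (forall x, `|g x| <= 1) ->
  mu.-integrable D (EFin \o (fun x => g x * phi x)).
Proof.
move=> mD cg g1; apply: (@integrableS _ _ _ _ setT) => //.
apply: (@le_integrable _ _ R mu setT measurableT (EFin \o (fun x => g x * phi x)) (EFin \o phi)) => //.
- apply/measurable_EFinP; apply: measurable_funM.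
    exact: continuous_measurable_fun.
  exact: measurable_normal_pdf.
- move=> x _ /=; rewrite lee_fin normrM.
  by rewrite -[leRHS]mul1r ler_wpM2r.
- exact: integrable_normal_pdf.
Qed.

Lemma integrable_normal_pdfS (D : set R) : measurable D ->
  mu.-integrable D (EFin \o phi).
Proof.
by move=> mD; apply: (@integrableS _ _ _ _ setT) => //; exact: integrable_normal_pdf.
Qed.

Lemma normal_probE (x : R) : normal_prob 0 1 `]-oo, x] = (normal_cdf x)%:E.
Proof.
rewrite /normal_cdf /Rintegral fineK //.
by apply: integrable_fin_num => //; exact: integrable_normal_pdfS.
Qed.

Lemma Rintegral_normal_pdf : \int[mu]_x phi x = 1.
Proof. by rewrite /Rintegral integral_normal_pdf. Qed.

Lemma Rintegral_splitNy (f : R -> R) (w : R) : mu.-integrable setT (EFin \o f) ->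
  \int[mu]_x f x =
  \int[mu]_(x in `]-oo, w]) f x + \int[mu]_(x in `]w, +oo[) f x.
Proof.
move=> fi.
have := @Rintegral_itvB R f -oo%O +oo%O w.
rewrite set_itvNyy => /(_ fi erefl erefl) <-; lra.
Qed.

Lemma Rintegral_le_normal (g : R -> R) (D : set R) : measurable D ->
  continuous g -> (forall x, `|g x| <= 1) ->
  `|\int[mu]_(x in D) (g x * phi x)| <= \int[mu]_(x in D) phi x.
Proof.
move=> mD cg g1; apply: le_trans (le_normr_Rintegral _ _) _ => //.
  exact: integrable_mul_normal_pdf.
apply: le_Rintegral => //.
- have -> : (fun t => `|g t * phi t|) = (fun t => `|g t| * phi t).
    by apply/funext => t; rewrite normrM (ger0_norm (normal_pdf_ge0 _ _ _)).
  apply: integrable_mul_normal_pdf => // x; last by rewrite normr_id.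
  exact: (continuous_comp (cg x) (@norm_continuous _ _ _)).
- exact: integrable_normal_pdfS.
- move=> x _; rewrite normrM (ger0_norm (normal_pdf_ge0 _ _ _)).
  by rewrite -[leRHS]mul1r ler_wpM2r ?normal_pdf_ge0.
Qed.

Lemma is_derive_gauss_primitive (g : R -> R) (x : R) :
  continuous g -> (forall x, `|g x| <= 1) ->
  is_derive x 1 (fun w : R => \int[mu]_(t in `]-oo, w]) (g t * phi t)) (g x * phi x).
Proof.
move=> cg g1.
have cf : {for x, continuous (fun x => g x * phi x)}.
  by apply: cvgM; [exact: cg | apply: continuous_normal_pdf; exact: oner_neq0].
have xx : x < x + 1 by rewrite ltrDl.
have [||dF F'] := @continuous_FTC1 R _ -oo%O x (x + 1) xx _ _ cf.
- exact: integrable_mul_normal_pdf.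
- by rewrite ltNyr.
by split; [exact: dF | rewrite -derive1E].
Qed.

Lemma is_derive_normal_cdf (x : R) : is_derive x 1 normal_cdf (phi x).
Proof.
have cg : continuous (cst 1 : R -> R) by move=> y; exact: cvg_cst.
have := @is_derive_gauss_primitive (cst 1) x cg.
rewrite /= mul1r => /(_ ltac:(by rewrite normr1)).
by under [X in is_derive _ _ X _]eq_fun do under eq_Rintegral do rewrite mul1r.
Qed.

Lemma normal_cdf_lipschitz (a b : R) : a <= b -> normal_cdf b - normal_cdf a <= b - a.
Proof.
move=> ab; have [c _ ->] := MVT_eq is_derive_normal_cdf ab.
by rewrite ler_piMl ?subr_ge0 // normal_pdf01_le1.
Qed.

(** The identity of the line as a random variable of normal law, so that the limits of a
    distribution function at infinity apply to [normal_cdf]. *)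
Let idR : measurableTypeR R -> R := idfun.

#[local] HB.instance Definition _ :=
  @isMeasurableFun.Build _ _ _ _ idR (@measurable_id _ _ setT).

Lemma cdf_idR (x : R) :
  cdf (idR : {RV (normal_prob (0 : R) 1) >-> R}) x = (normal_cdf x)%:E.
Proof. by rewrite -normal_probE. Qed.

Lemma normal_cdf_near0 (e x : R) : 0 < e -> exists2 y, y <= x & normal_cdf y < e.
Proof.
move=> e0.
have /fine_cvg/cvgr_lt/(_ e e0)[M [_ HM]] :=
  cvg_cdfNy0 (idR : {RV (normal_prob (0 : R) 1) >-> R}).
exists (Num.min x (M - 1)); first by rewrite ge_min lexx.
rewrite -[normal_cdf _]/(fine (normal_cdf _)%:E) -cdf_idR; apply: HM.
by rewrite gt_min ltrBlDr ltrDl ltr01 orbT.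
Qed.

Lemma normal_cdf_near1 (e x : R) : 0 < e -> exists2 y, x <= y & 1 - normal_cdf y < e.
Proof.
move=> e0.
have e1 : 1 - e < 1 by rewrite gtrBl.
have /fine_cvg/cvgr_gt/(_ (1 - e) e1)[M [_ HM]] :=
  cvg_cdfy1 (idR : {RV (normal_prob (0 : R) 1) >-> R}).
exists (Num.max x (M + 1)); first by rewrite le_max lexx.
rewrite ltrBlDr addrC -ltrBlDr.
rewrite -[normal_cdf _]/(fine (normal_cdf _)%:E) -cdf_idR; apply: HM.
by rewrite lt_max ltrDl ltr01 orbT.
Qed.

Lemma gauss_mean_bounds (h : R -> R) (a b : R) : continuous h ->
  (forall x, 0 <= h x <= 1) ->
  (forall x, x <= a -> h x = 1) -> (forall x, b <= x -> h x = 0) ->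
  normal_cdf a <= \int[mu]_x (h x * phi x) <= normal_cdf b.
Proof.
move=> ch h01 ha hb.
have h1 x : `|h x| <= 1.
  by have /andP[h0 h1] := h01 x; rewrite ger0_norm.
have hi := integrable_mul_normal_pdf measurableT ch h1.
apply/andP; split.
  rewrite (Rintegral_splitNy a hi) -[leLHS]addr0 lerD //.
    rewrite /normal_cdf le_eqVlt; apply/orP; left; apply/eqP.
    apply: eq_Rintegral => x; rewrite inE /= in_itv /= => xa.
    by rewrite ha // mul1r.
  apply: Rintegral_ge0 => x _; rewrite mulr_ge0 ?normal_pdf_ge0 //.
  by have /andP[] := h01 x.
rewrite (Rintegral_splitNy b hi) -[leRHS]addr0 lerD //.
  by apply: le_trans (ler_norm _) _; exact: Rintegral_le_normal.
under eq_Rintegral.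
  move=> x; rewrite inE /= in_itv /= andbT => /ltW xb.
  rewrite hb // mul0r; over.
by rewrite Rintegral_cst // mul0r.
Qed.

(** The bounds on [f] and [f'] do not involve the modulus of continuity of [h], so they are uniform
    in the ramp width; the slope of a ramp enters only through differences of [f']. *)
Lemma stein_solution (h : R -> R) : continuous h ->
  (forall x, 0 <= h x <= 1) ->
  exists f f' : R -> R,
  [/\ forall x : R, is_derive x 1 f (f' x),
      forall x, f' x = x * f x + h x - \int[mu]_x (h x * phi x),
      forall x, `|f x| <= 2 & forall x, `|f' x| <= 3].
Proof.
move=> ch h01.
have h1 x : `|h x| <= 1.
  by have /andP[h0 h1] := h01 x; rewrite ger0_norm.
set c := \int[mu]_x _.
have hi := integrable_mul_normal_pdf measurableT ch h1.
have c1 : c <= 1.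
  rewrite -Rintegral_normal_pdf; apply: le_trans (ler_norm _) _.
  exact: Rintegral_le_normal.
have c0 : 0 <= c.
  apply: Rintegral_ge0 => x _; rewrite mulr_ge0 ?normal_pdf_ge0 //.
  by have /andP[] := h01 x.
pose g x := h x - c.
have cg : continuous g.
  by move=> x; apply: cvgB; [exact: ch | exact: cvg_cst].
have g1 x : `|g x| <= 1.
  by rewrite ler_norml /g; have := h01 x; lra.
have gi := integrable_mul_normal_pdf measurableT cg g1.
(* The solution is [K / phi], where [K' = (h - c) phi] and [K] vanishes at both ends. *)
pose K w := \int[mu]_(t in `]-oo, w]) (g t * phi t).
have Kd (x : R) : is_derive x 1 K (g x * phi x).
  exact: is_derive_gauss_primitive.
have Kphi x : `|g x * phi x| <= phi x.
  by rewrite normrM (ger0_norm (normal_pdf_ge0 _ _ _)) ler_piMl ?normal_pdf_ge0.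
have tot : \int[mu]_x (g x * phi x) = 0.
  under eq_Rintegral do rewrite mulrBl.
  rewrite RintegralB //; last first.
    apply: (integrable_mul_normal_pdf (g := cst c)) => //.
      by move=> y; exact: cvg_cst.
    by move=> y /=; rewrite ger0_norm.
  rewrite RintegralZl //; last exact: integrable_normal_pdf.
  by rewrite Rintegral_normal_pdf mulr1 subrr.
have KNy x : `|K x| <= normal_cdf x by exact: Rintegral_le_normal.
(* The total integral of [g * phi] is 0, so [K x] is also minus the integral over the right tail. *)
have Ky x : `|K x| <= 1 - normal_cdf x.
  have J : `|\int[mu]_(t in `]x, +oo[) (g t * phi t)| <= \int[mu]_(t in `]x, +oo[) phi t.
    by apply: Rintegral_le_normal.
  have := Rintegral_splitNy x (integrable_normal_pdfS measurableT).
  rewrite Rintegral_normal_pdf -/(normal_cdf x) => E1.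
  have := Rintegral_splitNy x gi; rewrite tot -/(K x) => /esym/eqP.
  rewrite addr_eq0 => /eqP ->; rewrite normrN; apply: le_trans J _.
  by rewrite lerBrDl -E1.
have Kb : forall w, `|K w| <= 2 * phi w / (1 + `|w|).
  apply: (gauss_tail Kd Kphi).
  - move=> e x e0; have [y xy ye] := normal_cdf_near1 x e0.
    by exists y => //; exact: le_lt_trans (Ky y) ye.
  - move=> e x e0; have [y xy ye] := normal_cdf_near0 x e0.
    by exists y => //; exact: le_lt_trans (KNy y) ye.
have p0 w : 0 < phi w := normal_pdf01_gt0 w.
pose f w := K w / phi w.
have fb w : `|f w| <= 2 / (1 + `|w|).
  rewrite /f normrM normfV (ger0_norm (ltW (p0 w))) ler_pdivrMr //.
  by apply: le_trans (Kb w) _; rewrite mulrAC.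
have w1 (w : R) : 0 < 1 + `|w| by rewrite ltr_pwDl.
exists f, (fun x => x * f x + h x - c); split => //.
- move=> x.
  have Vd : is_derive x 1 (fun y : R => (phi y)^-1) (- (phi x) ^- 2 *: (- x * phi x)).
    apply: is_deriveV; first by rewrite gt_eqF.
    exact: is_derive_normal_pdf01.
  apply: is_derive_eq.
  rewrite /f /g /GRing.scale /=; field.
  by rewrite gt_eqF.
- move=> x; apply: le_trans (fb x) _.
  by rewrite ler_pdivrMr // mulrDr mulr1 lerDl mulr_ge0.
- move=> x; rewrite -addrA; apply: le_trans (ler_normD _ _) _.
  rewrite (_ : 3 = 2 + 1) ?lerD ?g1 //; last by rewrite -natr1.
  rewrite normrM; apply: (@le_trans _ _ (`|x| * (2 / (1 + `|x|)))).
    by rewrite ler_wpM2l.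
  by rewrite mulrA ler_pdivrMr // mulrDr mulr1; lra.
Qed.

End GaussInt.

(** * Averages over a finite set *)

Definition avg (R : realType) (T : finType) (f : T -> R) : R :=
  (\sum_(s : T) f s) / #|T|%:R.

Section Avg.
Variables (R : realType) (T : finType).
Implicit Types f g : T -> R.

Lemma eq_avg f g : f =1 g -> avg f = avg g.
Proof. by move=> fg; rewrite /avg; under eq_bigr do rewrite fg. Qed.

Lemma avgD f g : avg (fun s => f s + g s) = avg f + avg g.
Proof. by rewrite /avg big_split mulrDl. Qed.

Lemma avgZ (c : R) f : avg (fun s => c * f s) = c * avg f.
Proof. by rewrite /avg -mulr_sumr mulrA. Qed.

Lemma avgN f : avg (fun s => - f s) = - avg f.
Proof. by rewrite /avg sumrN mulNr. Qed.

Lemma avgB f g : avg (fun s => f s - g s) = avg f - avg g.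
Proof. by rewrite avgD avgN. Qed.

Lemma avg_sum (I : finType) (P : pred I) (F : I -> T -> R) :
  avg (fun s => \sum_(i | P i) F i s) = \sum_(i | P i) avg (F i).
Proof. by rewrite /avg exchange_big /= mulr_suml. Qed.

Lemma ler_avg f g : (forall s, f s <= g s) -> avg f <= avg g.
Proof. by move=> fg; rewrite /avg ler_wpM2r ?invr_ge0 // ler_sum. Qed.

Lemma avg_ge0 f : (forall s, 0 <= f s) -> 0 <= avg f.
Proof. by move=> f0; rewrite /avg divr_ge0 // sumr_ge0. Qed.

Lemma ler_norm_avg f : `|avg f| <= avg (fun s => `|f s|).
Proof.
by rewrite /avg normrM [X in _ * X <= _]ger0_norm ?invr_ge0 // ler_wpM2r ?invr_ge0 // ler_norm_sum.
Qed.

Lemma avg_perm (h : T -> T) f : injective h -> avg (fun s => f (h s)) = avg f.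
Proof. by move=> hi; rewrite /avg [in RHS](reindex_inj hi). Qed.

Hypothesis T0 : (0 < #|T|)%N.

Lemma avg_cst (c : R) : avg (fun _ : T => c) = c.
Proof.
rewrite /avg sumr_const -[c *+ _]mulr_natr mulfK //.
by rewrite pnatr_eq0 -lt0n.
Qed.

Lemma avg_sqr_ge f : avg f ^+ 2 <= avg (fun s => f s ^+ 2).
Proof.
have : 0 <= avg (fun s => (f s - avg f) ^+ 2) by apply: avg_ge0 => s; exact: sqr_ge0.
have -> : avg (fun s => (f s - avg f) ^+ 2) =
    avg (fun s => f s ^+ 2 - 2 * avg f * f s + avg f ^+ 2).
  by apply: eq_avg => s; ring.
by rewrite avgD avgB avgZ avg_cst; lra.
Qed.

Lemma avg_norm_le_sqrt f (v : R) : avg (fun s => f s ^+ 2) <= v ->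
  avg (fun s => `|f s|) <= Num.sqrt v.
Proof.
move=> fv; have n0 : 0 <= avg (fun s => `|f s|) by apply: avg_ge0.
rewrite -[leLHS]ger0_norm // -sqrtr_sqr ler_wsqrtr //.
apply: le_trans (avg_sqr_ge _) _.
by apply: le_trans fv; apply: ler_avg => s; rewrite real_normK ?num_real.
Qed.

Lemma avg_cauchy_schwarz f g :
  avg (fun s => f s * g s) ^+ 2 <= avg (fun s => f s ^+ 2) * avg (fun s => g s ^+ 2).
Proof.
set a := avg (fun s => f s ^+ 2); set b := avg (fun s => f s * g s).
set c := avg (fun s => g s ^+ 2).
have key (x y : R) : 0 <= x ^+ 2 * a - 2 * x * y * b + y ^+ 2 * c.
  have -> : x ^+ 2 * a - 2 * x * y * b + y ^+ 2 * c =
      avg (fun s => (x * f s - y * g s) ^+ 2).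
    rewrite /a /b /c -!avgZ -avgB -avgD.
    by apply: eq_avg => s; ring.
  by apply: avg_ge0 => s; exact: sqr_ge0.
have a0 : 0 <= a by apply: avg_ge0 => s; exact: sqr_ge0.
have [a_eq0|an0] := eqVneq a 0.
  have [->|b0] := eqVneq b 0; first by rewrite a_eq0 mul0r expr0n.
  (* With [a = 0] the form is linear in [x], and this choice gives it the value -1. *)
  have := key ((c + 1) / (2 * b)) 1; rewrite a_eq0.
  have -> : ((c + 1) / (2 * b)) ^+ 2 * 0 - 2 * ((c + 1) / (2 * b)) * 1 * b +
    1 ^+ 2 * c = -1 by field.
  by rewrite ler0N1.
have a1 : 0 < a by rewrite lt_def an0.
have := key b a.
have -> : b ^+ 2 * a - 2 * b * a * b + a ^+ 2 * c = a * (a * c - b ^+ 2) by ring.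
by rewrite pmulr_rge0 // subr_ge0.
Qed.

End Avg.

(** * Piecewise linear smoothing of an indicator *)

Definition ramp (R : realType) (z e x : R) : R :=
  Num.min 1 (Num.max 0 ((z + e - x) / e)).

Section Ramp.
Variables (R : realType) (z e : R).
Hypothesis e0 : 0 < e.

Lemma ramp01 x : 0 <= ramp z e x <= 1.
Proof. by rewrite /ramp le_min ge_min le_max !lexx ler01. Qed.

Lemma ramp1 x : x <= z -> ramp z e x = 1.
Proof.
move=> xz; apply/min_idPl; rewrite le_max; apply/orP; right.
by rewrite ler_pdivlMr // mul1r; lra.
Qed.

Lemma ramp0 x : z + e <= x -> ramp z e x = 0.
Proof.
move=> zx; rewrite /ramp (max_idPl _) ?(min_idPr _) ?ler01 //.
by rewrite ler_pdivrMr // mul0r; lra.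
Qed.

Lemma continuous_ramp : continuous (ramp z e).
Proof.
move=> x.
apply: (continuous_min (f := cst 1) (g := fun x : R => Num.max 0 ((z + e - x) / e))).
  exact: cvg_cst.
apply: (continuous_max (f := cst 0) (g := fun x : R => (z + e - x) / e)).
  exact: cvg_cst.
apply: cvgM; last exact: cvg_cst.
by apply: cvgB; [exact: cvg_cst | exact: cvg_id].
Qed.

Lemma ramp_lipschitz x y : `|ramp z e x - ramp z e y| <= `|x - y| / e.
Proof.
have key (u v : R) : `|Num.min 1 (Num.max 0 u) - Num.min 1 (Num.max 0 v)| <= `|u - v|.
  have mx (a b : R) : `|Num.max 0 a - Num.max 0 b| <= `|a - b|.
    have H1 := ler_norm (a - b); have H2 := ler_norm (- (a - b)).
    rewrite normrN in H2.
    by rewrite ler_norml; have [a0|a0] := leP 0 a; have [b0|b0] := leP 0 b; lra.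
  apply: le_trans (mx u v).
  set a := Num.max 0 u; set b := Num.max 0 v.
  have H1 := ler_norm (a - b); have H2 := ler_norm (- (a - b)).
  rewrite normrN in H2.
  by rewrite ler_norml; have [a0|a0] := leP 1 a; have [b0|b0] := leP 1 b; lra.
apply: le_trans (key _ _) _.
have -> : (z + e - x) / e - (z + e - y) / e = - (x - y) / e by rewrite -mulrBl; congr (_ / _); ring.
by rewrite normrM normrN (ger0_norm (x := e^-1)) ?invr_ge0 // ltW.
Qed.

(** A ramp is constant on either side of [[z, z + e]], so two points at distance at most [b] see a
    difference only near that interval. The window is half-open so that its indicator is a
    difference of two indicators of the form [w <= t]. *)
Lemma ramp_local (b w y : R) : `|y - w| <= b ->
  `|ramp z e y - ramp z e w| <= b / e * ((z - 2 * b < w) && (w <= z + e + b))%:R.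
Proof.
move=> yw; have b0 : 0 <= b by apply: le_trans yw.
have [w1|w1] := ltP (z - 2 * b) w; last first.
  rewrite mulr0; move: yw; rewrite ler_norml => /andP[y1 y2].
  by rewrite !ramp1 ?subrr ?normr0 //; lra.
have [w2|w2] := leP w (z + e + b); last first.
  rewrite mulr0; move: yw; rewrite ler_norml => /andP[y1 y2].
  by rewrite !ramp0 ?subrr ?normr0 //; lra.
rewrite mulr1; apply: le_trans (ramp_lipschitz _ _) _.
by rewrite ler_wpM2r ?invr_ge0 // ltW.
Qed.

End Ramp.

Lemma mvt_diff (R : realType) (f df : R -> R) (w u : R) :
  (forall x : R, is_derive x 1 f (df x)) ->
  exists2 c, `|c - w| <= `|u| & f w - f (w - u) = u * df c.
Proof.
move=> fd; have [u0|/ltW u0] := leP 0 u.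
  have wu : w - u <= w by lra.
  have [c c12 E] := MVT_eq fd wu.
  by exists c; [rewrite ler_norml ger0_norm; lra | rewrite E; ring].
have wu : w <= w - u by lra.
have [c c12 E] := MVT_eq fd wu.
exists c; first by rewrite ler_norml ler0_norm; lra.
by rewrite -[LHS]opprB E; ring.
Qed.

(** * Stein's method under local dependence *)

Section SteinLocal.
Variables (R : realType) (T I : finType) (xi : I -> T -> R) (nb : I -> pred I).
Variables (sg N D V : R).
Hypothesis T0 : (0 < #|T|)%N.
Hypothesis xi_indep : forall i (F : R -> R),
  avg (fun s => xi i s * F (\sum_(j | ~~ nb i j) xi j s)) = 0.
Hypothesis xi1 : forall i s, `|xi i s| <= 1.
Hypothesis cardI : #|I|%:R <= N.
Hypothesis cardnb : forall i, #|nb i|%:R <= D.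
Hypothesis sg0 : 0 < sg.
Hypothesis D0 : 0 < D.
Hypothesis N0 : 0 < N.
Hypothesis varE : avg (fun s => (\sum_i xi i s) ^+ 2) = sg ^+ 2.
Let Y i s := \sum_(j | nb i j) xi j s.
Let Q s := \sum_i xi i s * Y i s.
Hypothesis varQ : avg (fun s => (Q s - sg ^+ 2) ^+ 2) <= V.

Let W s := (\sum_i xi i s) / sg.
(** [b] bounds the change of [W] when one neighbourhood is removed; [A] is the usual third-order
    error, [N D / sg^2] times [b]. *)
Let b := D / sg.
Let A := N * D ^+ 2 / sg ^+ 3.

Lemma stein_avgW : avg (fun s => `|W s|) <= 1.
Proof.
rewrite -[leRHS]sqrtr1; apply: avg_norm_le_sqrt => //.
rewrite /W; under eq_avg do rewrite expr_div_n mulrC.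
by rewrite avgZ varE mulVf // expf_neq0 // gt_eqF.
Qed.

Lemma stein_Y_le i s : `|Y i s| <= D.
Proof.
apply: le_trans (ler_norm_sum _ _ _) _; apply: le_trans (cardnb i).
by rewrite -sumr_const; apply: ler_sum => j _; exact: xi1.
Qed.

(** [W - Y i / sg] involves only the terms outside the neighbourhood of [i], so subtracting
    [xi i * f (W - Y i / sg)] does not change the average. *)
Lemma stein_avg_Wf (f : R -> R) :
  avg (fun s => W s * f (W s)) =
  avg (fun s => \sum_i xi i s * (f (W s) - f (W s - Y i s / sg)) / sg).
Proof.
have E s : \sum_i xi i s * (f (W s) - f (W s - Y i s / sg)) / sg =
  W s * f (W s) -
  sg^-1 * \sum_i xi i s * f ((\sum_(j | ~~ nb i j) xi j s) / sg).
  have -> : W s * f (W s) = \sum_i xi i s * f (W s) / sg.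
    by rewrite {1}/W mulrAC -!mulr_suml.
  rewrite mulr_sumr -sumrB.
  apply: eq_bigr => i _.
  have -> : W s - Y i s / sg = (\sum_(j | ~~ nb i j) xi j s) / sg.
    by rewrite /W (bigID (nb i)) /= mulrDl addrC addKr.
  by ring.
rewrite (eq_avg E) avgB avgZ avg_sum big1 ?mulr0 ?subr0 // => i _.
exact: (xi_indep i (fun x => f (x / sg))).
Qed.

(** By Stein's equation the left side is the mean of [f' W - W * f W]. Replacing each difference of
    [f] by its linearization at [W] costs the fluctuation of [Q], bounded through [V], and the
    oscillation of [f'] over distance [b], bounded by [B]. [Delta] is an a priori bound for the very
    distance that is to be estimated. *)
Lemma stein_smooth (z e Delta : R) : 0 < e ->
  (forall t, `|avg (fun s => (W s <= t)%R%:R) - normal_cdf t| <= Delta) ->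
  `|avg (fun s => ramp z e (W s))
    - \int[@lebesgue_measure R]_x (ramp z e x * normal_pdf 0 1 x)|
  <= 3 * Num.sqrt V / sg ^+ 2 + A * (5 + (e + 3 * b + 2 * Delta) / e).
Proof.
move=> e0 HD; set c := \int[_]_x _.
have [f [f' [fd fE f2 f3]]] := stein_solution (@continuous_ramp R z e) (ramp01 z e).
rewrite -/c in fE.
have b0 : 0 <= b by rewrite /b divr_ge0 // ltW.
have sgn0 : sg != 0 by rewrite gt_eqF.
pose J s := ((z - 2 * b < W s) && (W s <= z + e + b))%:R : R.
pose B s := 3 * `|W s| * b + 2 * b + b / e * J s.
have B0 s : 0 <= B s.
  rewrite /B addr_ge0 // ?addr_ge0 //; last by rewrite mulr_ge0 ?ler0n // divr_ge0 // ltW.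
    by rewrite mulr_ge0 // mulr_ge0.
  by rewrite mulr_ge0.
have step i s : `|xi i s * (f (W s) - f (W s - Y i s / sg)) / sg -
    f' (W s) / sg ^+ 2 * (xi i s * Y i s)| <= D * B s / sg ^+ 2.
  have [x xW ->] := mvt_diff (W s) (Y i s / sg) fd.
  have {}xW : `|x - W s| <= b.
    apply: le_trans xW _; rewrite normrM normfV (gtr0_norm sg0) ler_wpM2r ?invr_ge0 ?(ltW sg0) //.
    exact: stein_Y_le.
  have -> : xi i s * (Y i s / sg * f' x) / sg - f' (W s) / sg ^+ 2 * (xi i s * Y i s) =
      xi i s * Y i s * (f' x - f' (W s)) / sg ^+ 2 by field.
  rewrite normrM (ger0_norm (x := (sg ^+ 2)^-1)) ?invr_ge0 ?sqr_ge0 //.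
  rewrite ler_wpM2r ?invr_ge0 ?sqr_ge0 // normrM ler_pM //.
    by rewrite normrM -[leRHS]mul1r ler_pM // stein_Y_le.
  (* Stein's equation stands in for a second derivative: the three pieces below are bounded by
     [3 |W| b], [2 b] and [ramp_local]. *)
  rewrite !fE.
  have -> : x * f x + ramp z e x - c - (W s * f (W s) + ramp z e (W s) - c) =
     W s * (f x - f (W s)) + (x - W s) * f x + (ramp z e x - ramp z e (W s)) by ring.
  apply: le_trans (ler_normD _ _) _; rewrite lerD //; last exact: ramp_local.
  apply: le_trans (ler_normD _ _) _.
  rewrite (normrM (W s)) (normrM (x - W s)) lerD //; last first.
    by rewrite mulrC ler_pM.
  rewrite [3 * _]mulrC -mulrA ler_wpM2l //.
  have [y _ yE] := mvt_diff x (x - W s) fd.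
  rewrite -[in X in `|_ - f X|](subKr x (W s)) yE normrM mulrC.
  by rewrite ler_pM.
have pw s : `|f' (W s) - \sum_i xi i s * (f (W s) - f (W s - Y i s / sg)) / sg| <=
    3 * `|Q s - sg ^+ 2| / sg ^+ 2 + N * D / sg ^+ 2 * B s.
  have -> : f' (W s) - \sum_i xi i s * (f (W s) - f (W s - Y i s / sg)) / sg =
    f' (W s) * - (Q s - sg ^+ 2) / sg ^+ 2 +
    - \sum_i (xi i s * (f (W s) - f (W s - Y i s / sg)) / sg -
    f' (W s) / sg ^+ 2 * (xi i s * Y i s)).
    by rewrite sumrB -mulr_sumr -/(Q s); field.
  apply: le_trans (ler_normD _ _) _; rewrite lerD //.
    rewrite 2!normrM normrN (ger0_norm (x := (sg ^+ 2)^-1)) ?invr_ge0 ?sqr_ge0 //.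
    by rewrite ler_wpM2r ?invr_ge0 ?sqr_ge0 // ler_wpM2r.
  rewrite normrN; apply: le_trans (ler_norm_sum _ _ _) _.
  apply: (@le_trans _ _ (\sum_(i : I) D * B s / sg ^+ 2)).
    by apply: ler_sum => i _; exact: step.
  rewrite sumr_const -[_ *+ #|I|]mulr_natl.
  have -> : N * D / sg ^+ 2 * B s = N * (D * B s / sg ^+ 2) by ring.
  by rewrite ler_wpM2r // divr_ge0 ?sqr_ge0 // mulr_ge0 // ltW.
(* The window has length [e + 3 b], the normal distribution function is 1-Lipschitz, and each end
   point costs [Delta]. *)
have avgJ : avg J <= e + 3 * b + 2 * Delta.
  have JE s : J s = (W s <= z + e + b)%R%:R - (W s <= z - 2 * b)%R%:R.
    rewrite /J; have [w1|w1] := leP (W s) (z - 2 * b); last by rewrite subr0.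
    have -> : W s <= z + e + b by lra.
    by rewrite subrr.
  rewrite (eq_avg JE) avgB.
  have := HD (z + e + b); have := HD (z - 2 * b).
  have ab : z - 2 * b <= z + e + b by lra.
  have := normal_cdf_lipschitz ab.
  rewrite !ler_norml; lra.
have -> : avg (fun s => ramp z e (W s)) - c =
    avg (fun s => f' (W s) - \sum_i xi i s * (f (W s) - f (W s - Y i s / sg)) / sg).
  rewrite [RHS]avgB -stein_avg_Wf -avgB -{1}[c](avg_cst T0) -avgB.
  by apply: eq_avg => s; rewrite fE; ring.
apply: le_trans (ler_norm_avg _) _; apply: le_trans (ler_avg pw) _.
rewrite avgD avgZ lerD //.
  under eq_avg do rewrite mulrAC.
  rewrite avgZ [X in _ <= X]mulrAC ler_wpM2l //.
    by rewrite divr_ge0 ?sqr_ge0.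
  exact: avg_norm_le_sqrt varQ.
have avgB' : avg B <= b * (5 + (e + 3 * b + 2 * Delta) / e).
  have -> : avg B = 3 * b * avg (fun s => `|W s|) + 2 * b + b / e * avg J.
    rewrite -[2 * b](avg_cst T0) -!avgZ -!avgD.
    by apply: eq_avg => s; rewrite /B; ring.
  have -> : b * (5 + (e + 3 * b + 2 * Delta) / e) =
    3 * b * 1 + 2 * b + b / e * (e + 3 * b + 2 * Delta) by ring.
  apply: lerD; first apply: lerD => //.
    by apply: ler_wpM2l; [rewrite mulr_ge0 | exact: stein_avgW].
  by apply: ler_wpM2l => //; rewrite divr_ge0 // ltW.
have -> : A = N * D / sg ^+ 2 * b by rewrite /A /b; field.
rewrite -[leRHS]mulrA; apply: ler_wpM2l => //.
by rewrite divr_ge0 ?sqr_ge0 // mulr_ge0 // ltW.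
Qed.

(* The smoothing bound at ramp width [8 A] contains only a quarter of the distance
   [Delta] to be estimated, so it can be absorbed. *)
Theorem stein_local t :
  `|avg (fun s => (W s <= t)%R%:R) - normal_cdf t| <=
  20 * (A + b + Num.sqrt V / sg ^+ 2).
Proof.
pose d (t : R) : R := `|avg (fun s => (W s <= t)%R%:R) - normal_cdf t|.
pose S := range d.
have cdf01 (x : R) : 0 <= normal_cdf x <= 1.
  rewrite -!lee_fin -normal_probE; apply/andP; split; first exact: measure_ge0.
  exact: probability_le1.
have F01 (x : R) : 0 <= avg (fun s => (W s <= x)%R%:R : R) <= 1.
  rewrite avg_ge0 //= -[leRHS](avg_cst T0); apply: ler_avg => s.
  by rewrite lern1 leq_b1.
have hS : has_sup S.
  split; first by exists (d 0), 0.
  exists 1 => _ [x _ <-]; rewrite /d ler_norml.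
  by have := cdf01 x; have := F01 x; lra.
have HD (x : R) : `|avg (fun s => (W s <= x)%R%:R) - normal_cdf x| <= sup S.
  by apply: ub_le_sup; [case: hS | exists x].
set Delta := sup S in HD.
have sgn0 : sg != 0 by rewrite gt_eqF.
have A0 : 0 < A.
  by apply: divr_gt0; [apply: mulr_gt0 => //; apply: exprn_gt0 | apply: exprn_gt0].
have b0 : 0 <= b by rewrite /b divr_ge0 // ltW.
have e0 : 0 < 8 * A by apply: mulr_gt0.
pose E := 3 * Num.sqrt V / sg ^+ 2 + A * (5 + (8 * A + 3 * b + 2 * Delta) / (8 * A)).
have EE : E = 3 * Num.sqrt V / sg ^+ 2 + 6 * A + 3 / 8 * b + Delta / 4.
  have idn (q a c x : R) : a != 0 ->
      q + a * (5 + (8 * a + 3 * c + 2 * x) / (8 * a)) = q + 6 * a + 3 / 8 * c + x / 4.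
    by move=> an0; field.
  by apply: idn; rewrite gt_eqF.
have smooth z := stein_smooth z e0 HD.
(* Absorbing [Delta / 4] leaves [3/4 Delta <= 14 A + 3/8 b + 3 sqrt V / sg^2], whence the factor
   20. *)
suff : Delta <= 8 * A + E.
  move: (HD t); rewrite EE => H1 H2; apply: le_trans H1 _.
  have : 0 <= Num.sqrt V / sg ^+ 2 by rewrite divr_ge0 ?sqr_ge0 ?sqrtr_ge0.
  lra.
apply: ge_sup; first by case: hS.
(* The lower bound uses the ramp that ends at [x], the upper bound the one that starts at [x];
   either one shifts the normal distribution function by at most [8 A]. *)
move=> _ [x _ <-]; rewrite /d ler_norml; apply/andP; split.
  have := smooth (x - 8 * A); rewrite -/E ler_norml => /andP[Hl _].
  have hc := @continuous_ramp R (x - 8 * A) (8 * A).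
  have /andP[c1 c2] := gauss_mean_bounds hc (ramp01 _ _) (ramp1 e0) (ramp0 e0).
  have le1 : avg (fun s => ramp (x - 8 * A) (8 * A) (W s)) <=
      avg (fun s => (W s <= x)%R%:R).
    apply: ler_avg => s; have [wx|wx] := leP (W s) x.
      by have /andP[] := ramp01 (x - 8 * A) (8 * A) (W s).
    by rewrite ramp0 //; lra.
  have ab : x - 8 * A <= x by lra.
  by have := normal_cdf_lipschitz ab; lra.
have := smooth x; rewrite -/E ler_norml => /andP[_ Hl].
have hc := @continuous_ramp R x (8 * A).
have /andP[c1 c2] := gauss_mean_bounds hc (ramp01 _ _) (ramp1 e0) (ramp0 e0).
have le1 : avg (fun s => (W s <= x)%R%:R) <= avg (fun s => ramp x (8 * A) (W s)).
  apply: ler_avg => s; have [wx|wx] := leP (W s) x; first by rewrite ramp1.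
  by have /andP[] := ramp01 x (8 * A) (W s).
have ab : x <= x + 8 * A by lra.
by have := normal_cdf_lipschitz ab; lra.
Qed.

End SteinLocal.

(** * Relative orders on disjoint position sets are independent *)

Section PermIndep.
Variables (R : realType) (n : nat).
Implicit Types (S : {set 'I_n}) (f g : 'S_n -> R) (s h : 'S_n).

Definition order_on S f := forall s s',
  {in S &, forall x y, (s x < s y)%N = (s' x < s' y)%N} -> f s = f s'.

Definition off_of S f := forall s s', {in ~: S, s =1 s'} -> f s = f s'.

Lemma card_perm_gt0 : (0 < #|{: 'S_n}|)%N.
Proof. by apply/card_gt0P; exists 1%g. Qed.

(** The index in the sorted list is the rank of [s x] within [S]; ranks allow the orders of two
    permutations on [S] to be matched. *)
Lemma ltn_index_sort (T : finType) (S : {set T}) (s : T -> nat) :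
  {in S &, injective s} ->
  {in S &, forall x y, (index x (sort (relpre s leq) (enum S)) <
     index y (sort (relpre s leq) (enum S)))%N = (s x < s y)%N}.
Proof.
move=> si; set e := sort _ _.
have tr : transitive (relpre s leq) by move=> x y z /=; exact: leq_trans.
have so : sorted (relpre s leq) e.
  by apply: sort_sorted => x y /=; exact: leq_total.
have me x : (x \in e) = (x \in S) by rewrite mem_sort mem_enum.
have key x y : x \in S -> y \in S -> (index x e < index y e)%N -> (s x < s y)%N.
  move=> xS yS xy; have := sorted_ltn_index tr so.
  move=> /(_ x y); rewrite !me => /(_ xS yS xy) /=.
  rewrite leq_eqVlt => /orP[/eqP sxy|//].
  by move: xy; rewrite (si _ _ xS yS sxy) ltnn.
move=> x y xS yS; apply/idP/idP; first exact: key.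
apply: contraTT; rewrite -!leqNgt leq_eqVlt => /orP[/eqP ixy|/key -/(_ yS xS)/ltnW //].
have -> : x = y; last by [].
by rewrite -(nth_index x (s := e) (x := x)) ?me // -ixy nth_index ?me.
Qed.

(** [h] sends the position of a given rank under [s'] to the position of the same rank under [s]. *)
Lemma perm_align S s s' : exists2 h, perm_on S h &
  {in S &, forall x y, (s (h x) < s (h y))%N = (s' x < s' y)%N}.
Proof.
have inj (t : 'S_n) : {in S &, injective (fun x => t x : nat)}.
  by move=> x y _ _ /ord_inj /perm_inj.
pose e := sort (relpre (fun x => s x : nat) leq) (enum S).
pose e' := sort (relpre (fun x => s' x : nat) leq) (enum S).
have me x : (x \in e) = (x \in S) by rewrite mem_sort mem_enum.
have me' x : (x \in e') = (x \in S) by rewrite mem_sort mem_enum.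
have se : size e = size e' by rewrite !size_sort.
have ue : uniq e by rewrite sort_uniq enum_uniq.
pose h x := if x \in S then nth x e (index x e') else x.
have hS x : x \in S -> h x \in S.
  by move=> xS; rewrite /h xS -me mem_nth // se index_mem me'.
have ih x : x \in S -> index (h x) e = index x e'.
  by move=> xS; rewrite /h xS index_uniq // se index_mem me'.
have hinj : injective h.
  move=> x y hxy.
  have hSE z : (h z \in S) = (z \in S).
    by have [zS|zS] := boolP (z \in S); [rewrite hS | rewrite /h !(negbTE zS)].
  have xyS : (x \in S) = (y \in S) by rewrite -hSE hxy hSE.
  have [xS|xS] := boolP (x \in S).
    have yS : y \in S by rewrite -xyS.
    have := ih _ xS; rewrite hxy ih // => ixy.
    by rewrite -[LHS](nth_index x (s := e')) ?me' // -ixy nth_index ?me'.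
  by move: hxy; rewrite /h -xyS (negbTE xS).
exists (perm hinj).
  by apply/fintype.subsetP => x; rewrite inE permE; apply: contraR => /negbTE xS; rewrite /h xS.
move=> x y xS yS; rewrite !permE.
rewrite -(ltn_index_sort (inj s)) ?hS // -(ltn_index_sort (inj s')) //.
by rewrite !ih.
Qed.

(** On [S] the order of [s'] is that of [h0 * s] for some [h0] supported on [S], and right
    multiplication by [h0] permutes the summation range. *)
Lemma sum_orbit_const S f s s' : order_on S f ->
  \sum_(h | perm_on S h) f (h * s)%g = \sum_(h | perm_on S h) f (h * s')%g.
Proof.
move=> fS; have [h0 h0S h0E] := perm_align S s s'.
have h0P h : perm_on S (h * h0)%g = perm_on S h.
  apply/idP/idP => [hh|hS]; last exact: perm_onM.
  by rewrite -[h](mulgK h0); apply: perm_onM => //; exact: perm_onV.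
rewrite (reindex_inj (mulIg h0)) /=; apply: eq_big => // h.
rewrite h0P => hS.
by apply: fS => x y xS yS; rewrite !permM h0E ?perm_closed.
Qed.

(** The orbit sum at a free base point is kept explicit because it serves twice: comparison with
    [g = 1] gives independence, and keeping only its term at [h = 1] gives a lower bound for
    [avg f]. *)
Lemma avg_orbit S f g s0 : order_on S f -> off_of S g ->
  avg (fun s => f s * g s) * #|[pred h | perm_on S h]|%:R =
  (\sum_(h | perm_on S h) f (h * s0)%g) * avg g.
Proof.
move=> fS gS.
have E h : perm_on S h -> avg (fun s => f s * g s) = avg (fun s => f (h * s)%g * g s).
  move=> hS; rewrite -(avg_perm _ (mulgI h)); apply: eq_avg => s.
  congr (_ * _); apply: gS => x; rewrite inE => xS.
  by rewrite permM (out_perm hS).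
rewrite mulr_natr -sumr_const (eq_bigr _ E) -avg_sum -avgZ.
apply: eq_avg => s; rewrite -mulr_suml; congr (_ * _).
exact: sum_orbit_const.
Qed.

Lemma perm_on_gt0 S : 0 < #|[pred h : 'S_n | perm_on S h]|%:R :> R.
Proof. by rewrite ltr0n; apply/card_gt0P; exists 1%g; rewrite inE perm_on1. Qed.

Lemma avg_indep S f g : order_on S f -> off_of S g ->
  avg (fun s => f s * g s) = avg f * avg g.
Proof.
move=> fS gS.
have H0 := lt0r_neq0 (perm_on_gt0 S).
apply: (mulIf H0); rewrite (avg_orbit 1%g fS gS) mulrAC; congr (_ * _).
have := avg_orbit 1%g fS (g := cst 1) (fun _ _ _ => erefl).
rewrite (avg_cst card_perm_gt0) mulr1 => <-.
by congr (_ * _); apply: eq_avg => s; rewrite mulr1.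
Qed.

Lemma avg_order_ge S f s0 : order_on S f -> (forall s, 0 <= f s) -> 1 <= f s0 ->
  ((#|S|)`!%:R)^-1 <= avg f.
Proof.
move=> fS f0 f1.
have := avg_orbit s0 fS (g := cst 1) (fun _ _ _ => erefl).
rewrite (avg_cst card_perm_gt0) mulr1.
have -> : avg (fun s => f s * cst 1 s) = avg f by apply: eq_avg => s; rewrite mulr1.
have -> : #|[pred h : 'S_n | perm_on S h]| = (#|S|)`!.
  by rewrite -card_perm; apply: eq_card => h; rewrite !inE.
move=> E.
have F0 : 0 < ((#|S|)`!)%:R :> R by rewrite ltr0n fact_gt0.
rewrite -(ler_pM2r F0) mulVf ?gt_eqF // E.
rewrite (bigD1 (1%g : 'S_n)) ?perm_on1 //= mul1g -[leLHS]addr0 lerD // sumr_ge0 //.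
Qed.

End PermIndep.

(** * Normal approximation for sums of functions of relative orders *)

Section DepCLT.
Variables (R : realType) (n : nat) (I : finType).
Variables (xi : I -> 'S_n -> R) (S : I -> {set 'I_n}) (N D sg : R).
Let nb i : pred I := fun j => ~~ [disjoint S i & S j]%B.
Hypothesis xiS : forall i, order_on (S i) (xi i).
Hypothesis xi0 : forall i, avg (xi i) = 0.
Hypothesis xi1 : forall i s, `|xi i s| <= 1.
Hypothesis cardI : #|I|%:R <= N.
Hypothesis cardnb : forall i, #|nb i|%:R <= D.
Hypothesis sg0 : 0 < sg.
Hypothesis D0 : 0 < D.
Hypothesis N0 : 0 < N.
Hypothesis varE : avg (fun s => (\sum_i xi i s) ^+ 2) = sg ^+ 2.

Lemma order_on_off (U V : {set 'I_n}) (f : 'S_n -> R) :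
  [disjoint U & V]%B -> order_on V f -> off_of U f.
Proof.
move=> UV fV s s' ss'; apply: fV => x y xV yV.
have out z : z \in V -> z \in ~: U.
  by rewrite inE; apply: contraL => zU; rewrite (disjointFr UV zU).
by rewrite !ss' ?out.
Qed.

Lemma order_onS (U V : {set 'I_n}) (f : 'S_n -> R) :
  U \subset V -> order_on U f -> order_on V f.
Proof.
move=> /fintype.subsetP UV fU s s' ss'; apply: fU => x y xU yU.
by apply: ss'; exact: UV.
Qed.

Lemma dep_indep i (F : R -> R) :
  avg (fun s => xi i s * F (\sum_(j | ~~ nb i j) xi j s)) = 0.
Proof.
rewrite (avg_indep (@xiS i)) ?xi0 ?mul0r // => s s' ss'; congr F.
apply: eq_bigr => j; rewrite negbK => ij.
exact: (order_on_off ij (@xiS j)).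
Qed.

Let a i j : R := (nb i j)%:R.

Lemma dep_a_sum i : \sum_j a i j <= D.
Proof.
apply: le_trans (cardnb i); rewrite -sumr_const [leRHS]big_mkcond /=.
apply: ler_sum => j _; rewrite /a -[j \in nb i]/(nb i j).
by case: (nb i j).
Qed.

Lemma dep_a_sym i j : a i j = a j i.
Proof. by rewrite /a /nb disjoint_sym. Qed.

Lemma dep_a_ge0 i j : 0 <= a i j. Proof. exact: ler0n. Qed.

(** The sum counts paths [j - i - i' - j'] in the dependency graph: at most [N] choices for [i] and
    [D] for each of the three edges. *)
Lemma dep_path3 :
  \sum_i \sum_j \sum_i' \sum_j' a i j * a i i' * a i' j' <= N * D ^+ 3.
Proof.
have D0' : 0 <= D by exact: ltW.
apply: (@le_trans _ _ (\sum_(i : I) D ^+ 3)); last first.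
  by rewrite sumr_const -mulr_natl ler_wpM2r // exprn_ge0.
apply: ler_sum => i _.
apply: (@le_trans _ _ (\sum_j \sum_i' a i j * a i i' * D)).
  apply: ler_sum => j _; apply: ler_sum => i' _.
  by rewrite -mulr_sumr ler_wpM2l ?mulr_ge0 ?dep_a_ge0 ?dep_a_sum.
apply: (@le_trans _ _ (\sum_j a i j * D * D)).
  apply: ler_sum => j _; rewrite -mulr_suml -mulr_sumr.
  by rewrite ler_wpM2r // ler_wpM2l ?dep_a_ge0 ?dep_a_sum.
rewrite -!mulr_suml 2!exprSr expr1 !ler_wpM2r //.
exact: dep_a_sum.
Qed.

Let eta i j s := xi i s * xi j s - avg (fun s => xi i s * xi j s).

Lemma dep_eta_order i j : order_on (S i :|: S j) (eta i j).
Proof.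
have Si : S i \subset S i :|: S j by exact: finset.subsetUl.
have Sj : S j \subset S i :|: S j by exact: finset.subsetUr.
by move=> s s' ss'; rewrite /eta (order_onS Si (@xiS i) ss') (order_onS Sj (@xiS j) ss').
Qed.

Lemma dep_eta_le2 i j s : `|eta i j s| <= 2.
Proof.
have prod1 s' : `|xi i s' * xi j s'| <= 1.
  by rewrite normrM -[leRHS]mulr1 ler_pM.
apply: le_trans (ler_normB _ _) _; rewrite -[2]/(1 + 1) lerD //.
apply: le_trans (ler_norm_avg _) _.
by rewrite -[leRHS](avg_cst (card_perm_gt0 n)); exact: ler_avg.
Qed.

Lemma dep_eta_avg i j : avg (eta i j) = 0.
Proof. by rewrite /eta avgB (avg_cst (card_perm_gt0 n)) subrr. Qed.

(** If none of the four cross pairs is adjacent, the two position sets are disjoint and the centered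
    products are independent; otherwise the bracket is at least 1 and the trivial bound [2 * 2]
    applies. *)
Lemma dep_eta_cov i j i' j' :
  avg (fun s => eta i j s * eta i' j' s) <= 4 * (a i i' + a i j' + a j i' + a j j').
Proof.
have [dis|ndis] := boolP [disjoint S i :|: S j & S i' :|: S j']%B.
  rewrite (avg_indep (@dep_eta_order i j)); last first.
    exact: (order_on_off dis (@dep_eta_order i' j')).
  by rewrite dep_eta_avg mul0r mulr_ge0 // !addr_ge0 ?dep_a_ge0.
apply: (@le_trans _ _ 4).
  rewrite -[leRHS](avg_cst (card_perm_gt0 n)); apply: ler_avg => s.
  apply: le_trans (ler_norm _) _; rewrite normrM.
  by rewrite (_ : 4 = 2 * 2 :> R) ?ler_pM ?dep_eta_le2 // -natrM.
rewrite ler_peMr // -!natrD ler1n lt0n; apply: contra ndis.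
rewrite !addn_eq0 !eqb0 !negbK => /andP[/andP[/andP[d1 d2] d3] d4].
apply/pred0P => x /=; rewrite !inE; apply/negP => /andP[/orP[x1|x1] /orP[x2|x2]].
- by have := disjointFr d1 x1; rewrite x2.
- by have := disjointFr d2 x1; rewrite x2.
- by have := disjointFr d3 x1; rewrite x2.
- by have := disjointFr d4 x1; rewrite x2.
Qed.

Let Q s := \sum_i xi i s * \sum_(j | nb i j) xi j s.

Lemma dep_QE s : Q s = \sum_i \sum_j a i j * (xi i s * xi j s).
Proof.
apply: eq_bigr => i _; rewrite mulr_sumr big_mkcond /=; apply: eq_bigr => j _.
by rewrite /a; case: (nb i j); rewrite ?mul1r ?mul0r.
Qed.

(** Pairs that are not neighbours are uncorrelated, so the neighbouring pairs carry the whole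
    variance. *)
Lemma dep_Q_avg : avg Q = sg ^+ 2.
Proof.
rewrite -varE (eq_avg dep_QE).
have E s : (\sum_i xi i s) ^+ 2 = \sum_i \sum_j xi i s * xi j s.
  by rewrite expr2 big_distrlr.
rewrite (eq_avg E) !avg_sum; apply: eq_bigr => i _.
rewrite !avg_sum; apply: eq_bigr => j _; rewrite avgZ.
rewrite /a; have [ij|ij] := boolP (nb i j); first by rewrite mul1r.
rewrite mul0r (avg_indep (@xiS i)) ?xi0 ?mul0r //.
by apply: order_on_off (@xiS j); move: ij; rewrite /nb negbK.
Qed.

(** Expanding the square and bounding each covariance leaves four sums, each a relabelling of the
    path count [dep_path3]; 16 is the factor 4 of [dep_eta_cov] times these four sums. *)
Lemma dep_Q_var : avg (fun s => (Q s - sg ^+ 2) ^+ 2) <= 16 * N * D ^+ 3.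
Proof.
have QE s : Q s - sg ^+ 2 = \sum_i \sum_j a i j * eta i j s.
  rewrite -dep_Q_avg (eq_avg dep_QE) avg_sum dep_QE -sumrB.
  apply: eq_bigr => i _; rewrite avg_sum -sumrB; apply: eq_bigr => j _.
  by rewrite avgZ -mulrBr.
have E s : (Q s - sg ^+ 2) ^+ 2 = \sum_i \sum_j \sum_i' \sum_j'
    a i j * a i' j' * (eta i j s * eta i' j' s).
  rewrite QE expr2 mulr_suml; apply: eq_bigr => i _.
  rewrite mulr_suml; apply: eq_bigr => j _.
  rewrite mulr_sumr; apply: eq_bigr => i' _.
  by rewrite mulr_sumr; apply: eq_bigr => j' _; ring.
rewrite (eq_avg E) avg_sum.
apply: (@le_trans _ _ (\sum_i \sum_j \sum_i' \sum_j'
    a i j * a i' j' * (4 * (a i i' + a i j' + a j i' + a j j')))).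
  apply: ler_sum => i _; rewrite avg_sum; apply: ler_sum => j _.
  rewrite avg_sum; apply: ler_sum => i' _; rewrite avg_sum; apply: ler_sum => j' _.
  by rewrite avgZ ler_wpM2l ?mulr_ge0 ?dep_a_ge0 ?dep_eta_cov.
have -> : \sum_i \sum_j \sum_i' \sum_j'
    a i j * a i' j' * (4 * (a i i' + a i j' + a j i' + a j j')) =
  4 * (\sum_i \sum_j \sum_i' \sum_j' a i j * a i i' * a i' j' +
  \sum_i \sum_j \sum_i' \sum_j' a i j * a i j' * a j' i' +
  \sum_i \sum_j \sum_i' \sum_j' a j i * a j i' * a i' j' +
  \sum_i \sum_j \sum_i' \sum_j' a j i * a j j' * a j' i').
  rewrite -!big_split /= mulr_sumr; apply: eq_bigr => i _.
  rewrite -!big_split /= mulr_sumr; apply: eq_bigr => j _.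
  rewrite -!big_split /= mulr_sumr; apply: eq_bigr => i' _.
  rewrite -!big_split /= mulr_sumr; apply: eq_bigr => j' _.
  by rewrite (dep_a_sym j i) (dep_a_sym j' i'); ring.
have -> : 16 * N * D ^+ 3 = 4 * (N * D ^+ 3 + N * D ^+ 3 + N * D ^+ 3 + N * D ^+ 3) by ring.
rewrite ler_wpM2l // !lerD //; first exact: dep_path3.
- apply: le_trans dep_path3; rewrite le_eqVlt; apply/orP; left; apply/eqP.
  by apply: eq_bigr => i _; apply: eq_bigr => j _; rewrite exchange_big.
- apply: le_trans dep_path3; rewrite le_eqVlt; apply/orP; left; apply/eqP.
  by rewrite exchange_big.
- apply: le_trans dep_path3; rewrite le_eqVlt; apply/orP; left; apply/eqP.
  rewrite exchange_big; apply: eq_bigr => i _; apply: eq_bigr => j _.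
  by rewrite exchange_big.
Qed.

Theorem dep_clt t :
  `|avg (fun s => ((\sum_i xi i s) / sg <= t)%R%:R) - normal_cdf t| <=
  20 * (N * D ^+ 2 / sg ^+ 3 + D / sg + Num.sqrt (16 * N * D ^+ 3) / sg ^+ 2).
Proof.
apply: (stein_local (card_perm_gt0 n) dep_indep) => //.
exact: dep_Q_var.
Qed.

End DepCLT.

(** * Counting position vectors *)

Section Positions.
Variables (k n : nat) (A : {set 'I_k.-1}).
Implicit Types (i : {ffun 'I_k -> 'I_n}) (r t c : 'I_k).

Definition valid i : bool :=
  [forall r : 'I_k, forall t : 'I_k, (r < t)%N ==> (i r < i t)%N] &&
  [forall a in A, forall r : 'I_k, forall t : 'I_k,
     (r == a :> nat) && (t == a.+1 :> nat) ==> (i t == (i r).+1 :> nat)].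

(** With 0-based indices, [a] in [A] glues the index [a.+1] to its predecessor [a]. *)
Definition glued (m : nat) : bool := [exists a in A, a.+1 == m].

(* The first index of the block of forced adjacencies containing [m]. *)
Fixpoint bstart (m : nat) : nat :=
  if m is m'.+1 then if glued m'.+1 then bstart m' else m'.+1 else 0.

Lemma bstart_le m : (bstart m <= m)%N.
Proof. by elim: m => //= m IH; case: ifP => // _; exact: leqW. Qed.

Definition bs r : 'I_k := Ordinal (leq_ltn_trans (bstart_le r) (ltn_ord r)).

(** One index per block of adjacent positions, so [#|starts|] is the exponent [j]. *)
Definition starts : {set 'I_k} := [set r | bs r == r].

Lemma bstart_between m p : (bstart m <= p <= m)%N -> bstart p = bstart m.
Proof.
elim: m p => [|m IH] p /=.
  by rewrite leqn0 => /eqP ->.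
case: ifP => [gm|gm] /andP[p1 p2].
  move: p2; rewrite leq_eqVlt => /orP[/eqP ->|p2]; first by rewrite /= gm.
  by apply: IH; rewrite p1.
have -> : p = m.+1 by apply/eqP; rewrite eqn_leq p2.
by rewrite /= gm.
Qed.

Lemma bs_id r : bs (bs r) = bs r.
Proof. by apply: val_inj; rewrite /= (bstart_between (m := r)) // leqnn bstart_le. Qed.

Lemma bs_in r : bs r \in starts.
Proof. by rewrite inE bs_id. Qed.

Lemma bs_lt r t : (r < t)%N -> bs r != bs t -> (r < bs t)%N.
Proof.
move=> rt; apply: contraR; rewrite -leqNgt => h.
apply/eqP/val_inj; rewrite /= (bstart_between (m := t)) //.
by rewrite h ltnW.
Qed.

Lemma valid_lt i r t : valid i -> (r < t)%N -> (i r < i t)%N.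
Proof. by move=> /andP[/forallP/(_ r)/forallP/(_ t)/implyP]. Qed.

Lemma valid_le i r t : valid i -> (r <= t)%N -> (i r <= i t)%N.
Proof.
move=> vi; rewrite leq_eqVlt => /orP[/eqP/val_inj -> //|rt].
exact: ltnW (valid_lt vi rt).
Qed.

Lemma valid_inj i : valid i -> injective i.
Proof.
move=> vi r t irt; apply: val_inj; apply/eqP; rewrite eqn_leq.
by apply/andP; split; rewrite leqNgt; apply/negP => /(valid_lt vi); rewrite irt ltnn.
Qed.

Lemma valid_glued i r t : valid i -> glued t -> t = r.+1 :> nat -> i t = (i r).+1 :> nat.
Proof.
move=> /andP[_ /forallP va] /existsP[a /andP[aA /eqP at_]] tr.
have := va a; rewrite aA /= => /forallP/(_ r)/forallP/(_ t)/implyP h.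
by apply/eqP/h; rewrite -at_ eqxx andbT; apply/eqP; move: at_; rewrite tr => -[].
Qed.

Lemma valid_bs i r : valid i -> i r = (i (bs r) + (r - bs r))%N :> nat.
Proof.
move=> vi; move: {2}(r : nat) (leqnn r) => m; elim: m r => [|m IH] r.
  rewrite leqn0 => /eqP r0.
  have -> : bs r = r by apply: val_inj; rewrite /= r0.
  by rewrite subnn addn0.
rewrite leq_eqVlt => /orP[/eqP rm|]; last by rewrite ltnS; exact: IH.
have [gr|gr] := boolP (glued r); last first.
  have -> : bs r = r.
    by apply: val_inj; rewrite /= rm /= -rm (negbTE gr).
  by rewrite subnn addn0.
have mk : (m < k)%N by rewrite -ltnS -rm; apply: leq_trans (ltn_ord r) _.
pose p := Ordinal mk.
have -> : bs r = bs p.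
  by apply: val_inj; rewrite /= rm /= -rm gr.
rewrite (valid_glued (r := p) vi gr) // (IH p) // rm -addnS subSn //.
exact: bstart_le.
Qed.

(* A valid vector is determined by one entry in each block. *)
Lemma card_valid_le (Rep : {set 'I_k}) (V : 'I_k -> {set 'I_n}) :
  (forall r, exists2 c, c \in Rep & bs c = bs r) ->
  (#|[set i | valid i & [forall c in Rep, i c \in V c]]| <=
   \prod_(c in Rep) #|V c|)%N.
Proof.
move=> RepP; set P := [set i | _ & _].
pose phi i : {ffun 'I_k -> option 'I_n} :=
  [ffun c => if c \in Rep then Some (i c) else None].
have phi_inj : {in P &, injective phi}.
  move=> i i'; rewrite !inE => /andP[vi _] /andP[vi' _] ii'.
  have onRep c : c \in Rep -> i c = i' c.
    by move=> cR; move/ffunP: ii' => /(_ c); rewrite !ffunE cR => -[].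
  apply/ffunP => r; apply: val_inj => /=.
  have [c cR cr] := RepP r.
  have := congr1 val (onRep c cR); rewrite /= (valid_bs c vi) (valid_bs c vi') cr.
  move=> /eqP; rewrite eqn_add2r => /eqP E.
  by rewrite (valid_bs r vi) (valid_bs r vi') E.
rewrite -(card_in_imset phi_inj).
pose F (c : 'I_k) := mem (Some @: V c).
have -> : (\prod_(c in Rep) #|V c| = #|pfamily None Rep F|)%N.
  rewrite card_pfamily foldrE big_image; apply: eq_bigr => c _.
  by rewrite /F card_imset // => x y [].
apply: subset_leq_card; apply/fintype.subsetP => _ /imsetP[i iP ->].
move: iP; rewrite inE => /andP[vi /forallP iV].
apply/pfamilyP; split.
  by apply/fintype.subsetP => c; rewrite inE ffunE; case: ifP.
move=> c cR; rewrite ffunE cR; apply: imset_f.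
by have := iV c; rewrite cR.
Qed.

Lemma card_valid : (#|[set i | valid i]%SET| <= n ^ #|starts|)%N.
Proof.
have := @card_valid_le starts (fun _ => [set: 'I_n]%SET).
rewrite prod_nat_const cardsT card_ord => h; apply: leq_trans (h _).
  apply: subset_leq_card; apply/fintype.subsetP => i; rewrite !inE => ->.
  by apply/forallP => c; apply/implyP => _; rewrite inE.
by move=> r; exists (bs r); rewrite ?bs_in ?bs_id.
Qed.

Lemma card_valid_at r (x : 'I_n) :
  (#|[set i | valid i & i r == x]| <= n ^ #|starts|.-1)%N.
Proof.
(* [r] represents its block in place of the start of that block, so that the constraint at [r] falls
   on a representative. *)
pose Rep := r |: (starts :\ bs r).
pose V c : {set 'I_n} := if c == r then [set x]%SET else [set: 'I_n]%SET.
have rn : r \notin starts :\ bs r.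
  by rewrite !inE negb_and negbK eq_sym orbN.
have E : (\prod_(c in Rep) #|V c| = n ^ #|starts|.-1)%N.
  rewrite big_setU1 //= [V r]/V eqxx cards1 mul1n.
  rewrite (eq_bigr (fun _ => n)); last first.
    move=> c cS; rewrite /V ifF ?cardsT ?card_ord //.
    by apply/negP => /eqP cr; move: cS; rewrite cr (negbTE rn).
  rewrite prod_nat_const; congr (_ ^ _)%N.
  by rewrite [in RHS](cardsD1 (bs r) starts) bs_in.
have := @card_valid_le Rep V; rewrite E.
move=> h; apply: leq_trans (h _).
  apply: subset_leq_card; apply/fintype.subsetP => i; rewrite !inE => /andP[-> /eqP ir].
  apply/forallP => c; rewrite /V; apply/implyP => _; case: eqP => [->|_]; last by rewrite inE.
  by rewrite inE ir.
move=> t; have [tr|tr] := eqVneq (bs t) (bs r).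
  by exists r; rewrite ?inE ?eqxx.
by exists (bs t); rewrite ?bs_id // !inE bs_id eqxx tr orbT.
Qed.

Lemma card_valid_at2 r e (W : {set 'I_n}) : bs r != bs e ->
  (#|[set i | valid i & (i r \in W) && (i e \in W)]| <= #|W| ^ 2 * n ^ #|starts|.-2)%N.
Proof.
move=> re.
pose St' := starts :\ bs r :\ bs e.
pose Rep := r |: (e |: St').
pose V c : {set 'I_n} := if (c == r) || (c == e) then W else [set: 'I_n]%SET.
have en : e \notin St'.
  by rewrite !inE; apply/negP => /and3P[+ _ /eqP h]; rewrite h eqxx.
have rn : r \notin e |: St'.
  rewrite !inE negb_or; apply/andP; split.
    by apply: contraNneq re => ->.
  by apply/negP => /and3P[_ + /eqP h]; rewrite h eqxx.
have E : (\prod_(c in Rep) #|V c| = #|W| ^ 2 * n ^ #|starts|.-2)%N.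
  rewrite !big_setU1 //= [V r]/V [V e]/V !eqxx /= orbT mulnA mulnn.
  rewrite (eq_bigr (fun _ => n)); last first.
    move=> c cS; rewrite /V ifF ?cardsT ?card_ord //.
    apply/negP => /orP[] /eqP cr; move: cS rn en; rewrite cr; last by move=> ->.
    by move=> rS; rewrite in_setU1 rS orbT.
  rewrite prod_nat_const; congr (_ * _ ^ _)%N.
  rewrite [in RHS](cardsD1 (bs r) starts) bs_in (cardsD1 (bs e) (starts :\ bs r)).
  by rewrite !inE bs_id eqxx eq_sym re.
have := @card_valid_le Rep V; rewrite E.
move=> h; apply: leq_trans (h _).
  apply: subset_leq_card; apply/fintype.subsetP => i; rewrite !inE => /and3P[-> ir ie].
  apply/forallP => c; rewrite /V; apply/implyP => _.
  by case: ifP => [/orP[] /eqP -> //|_]; rewrite inE.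
move=> t; have [tr|tr] := eqVneq (bs t) (bs r).
  by exists r; rewrite ?inE ?eqxx.
have [te|te] := eqVneq (bs t) (bs e).
  by exists e; rewrite ?inE ?eqxx ?orbT.
by exists (bs t); rewrite ?bs_id // !inE bs_id eqxx tr te !orbT.
Qed.

End Positions.

Section PositionsLower.
Variables (k n : nat) (A : {set 'I_k.-1}).
Local Notation valid := (@valid k n A).
Local Notation bs := (@bs k A).
Local Notation starts := (starts A).

(** The start of each block ranges freely over its own interval of length [L c]; the gaps of length
    [k] between intervals leave room for the rest of the block, so distinct blocks never collide. *)
Lemma card_valid_ge (off L : 'I_k -> nat) : (0 < k)%N ->
  {in starts &, forall c c' : 'I_k, (c < c')%N -> (off c + L c + k <= off c')%N} ->
  {in starts, forall c : 'I_k, (off c + L c + k <= n)%N} ->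
  (\prod_(c in starts) L c <=
   #|[set i | valid i & [forall c in starts, off c <= i c < off c + L c]]|)%N.
Proof.
move=> k0 offS offn; set P := [set i | _ & _].
have n0 : (0 < n)%N.
  by apply: leq_trans (offn _ (bs_in A (Ordinal k0))); rewrite addn_gt0 k0 orbT.
pose x0 : 'I_n := Ordinal n0.
pose F (c : 'I_k) := [pred y : 'I_n | (y < L c)%N].
have -> : (\prod_(c in starts) L c = #|pfamily x0 starts F|)%N.
  rewrite card_pfamily foldrE big_image; apply: eq_bigr => c cS.
  have Ln : (L c <= n)%N by apply: leq_trans (offn c cS); lia.
  have wi : injective (widen_ord Ln) by move=> x y /(congr1 val) /= /val_inj.
  rewrite -{1}[L c]card_ord -(fintype.card_image wi).
  apply: eq_card => y; apply/fintype.imageP/idP => [[x _ ->]|].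
    by rewrite inE /=; exact: ltn_ord.
  rewrite inE => yL.
  by exists (Ordinal yL) => //; apply: val_inj.
pose v (g : {ffun 'I_k -> 'I_n}) (r : 'I_k) := (off (bs r) + g (bs r) + (r - bs r))%N.
pose psi (g : {ffun 'I_k -> 'I_n}) : {ffun 'I_k -> 'I_n} := [ffun r => insubd x0 (v g r)].
have gL (g : {ffun 'I_k -> 'I_n}) c : g \in pfamily x0 starts F -> c \in starts -> (g c < L c)%N.
  by move=> /pfamilyP[_ h] /h.
have vlt (g : {ffun 'I_k -> 'I_n}) r : g \in pfamily x0 starts F -> (v g r < off (bs r) + L (bs r) + k)%N.
  by move=> /gL/(_ (bs_in A r)); rewrite /v; have := ltn_ord r; lia.
have psiE (g : {ffun 'I_k -> 'I_n}) r : g \in pfamily x0 starts F -> psi g r = v g r :> nat.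
  move=> gF; rewrite ffunE val_insubd ifT //.
  exact: leq_trans (vlt g r gF) (offn _ (bs_in A r)).
have bsle r : (bs r <= r)%N by exact: bstart_le.
have psiV (g : {ffun 'I_k -> 'I_n}) : g \in pfamily x0 starts F -> valid (psi g).
  move=> gF; apply/andP; split.
    apply/forallP => r; apply/forallP => t; apply/implyP => rt; rewrite !psiE //.
    have [bb|bb] := eqVneq (bs r) (bs t).
      by rewrite /v bb; have := bsle r; have := bsle t; rewrite bb; lia.
    have := bs_lt rt bb => rbt.
    apply: leq_trans (vlt g r gF) _.
    apply: leq_trans (offS _ _ (bs_in A r) (bs_in A t) (leq_ltn_trans (bsle r) rbt)) _.
    by rewrite /v; lia.
  apply/forallP => a; apply/implyP => aA; apply/forallP => r; apply/forallP => t.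
  apply/implyP => /andP[/eqP ra /eqP ta]; rewrite !psiE //.
  have ga : glued A a.+1 by apply/existsP; exists a; rewrite aA eqxx.
  have bb : bs t = bs r by apply: val_inj; rewrite /= ta ra /= ga.
  by rewrite /v bb ta ra; have := bsle r; rewrite ra; lia.
have psi_inj : {in pfamily x0 starts F &, injective psi}.
  move=> g g' gF gF' gg; apply/ffunP => c.
  have [cS|cS] := boolP (c \in starts).
    have /eqP cc : bs c == c by move: cS; rewrite inE.
    have := congr1 (fun h : {ffun 'I_k -> 'I_n} => h c : nat) gg.
    rewrite /= !psiE // /v cc => h; apply: val_inj => /=; lia.
  move/pfamilyP: gF => [/supportP gS _]; move/pfamilyP: gF' => [/supportP gS' _].
  by rewrite gS ?gS'.
rewrite -(fintype.card_in_image psi_inj); apply: subset_leq_card.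
apply/fintype.subsetP => _ /fintype.imageP[g gF ->]; rewrite inE psiV //=.
apply/forallP => c; apply/implyP => cS; rewrite psiE // /v.
have /eqP cc : bs c == c by move: cS; rewrite inE.
by rewrite cc; have := gL g c gF cS; lia.
Qed.

End PositionsLower.

Definition matches (k n : nat) (pi : 'S_k) (s : 'S_n) (i : {ffun 'I_k -> 'I_n}) : bool :=
  [forall r : 'I_k, forall t : 'I_k, (pi r < pi t)%N == (s (i r) < s (i t))%N].

Definition imset_of (k n : nat) (i : {ffun 'I_k -> 'I_n}) : {set 'I_n} :=
  [set i r | r : 'I_k].

Lemma card_top (n q : nat) : (q <= n)%N ->
  #|[set v : 'I_n | (n - q <= v)%N]%SET| = q.
Proof.
move=> qn.
have nq : (n - (n - q) = q)%N by rewrite subKn.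
rewrite -[RHS]nq -[RHS]card_ord.
have h (j : 'I_(n - (n - q))) : (n - q + j < n)%N by have := ltn_ord j; lia.
pose f (j : 'I_(n - (n - q))) : 'I_n := Ordinal (h j).
have fi : injective f by move=> x y /(congr1 val) /= /addnI /val_inj.
rewrite -(fintype.card_image fi); apply: eq_card => v.
apply/idP/fintype.imageP => [|[x _ ->]]; last by rewrite inE /= leq_addr.
rewrite inE => nv.
have v2 : (v - (n - q) < n - (n - q))%N by have := ltn_ord v; lia.
by exists (Ordinal v2) => //; apply: val_inj; rewrite /= subnKC.
Qed.

(** * Lower bound for the variance *)

Section TopValues.
Variables (R : realType) (n : nat) (B : {set 'I_n}).
Local Notation b v := ((v \in B)%:R : R).
Let beta : R := #|B|%:R / n%:R.

Lemma sum_mem_perm (s : 'S_n) : \sum_y b (s y) = #|B|%:R.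
Proof.
rewrite -sumr_const [RHS]big_mkcond [RHS](reindex_inj (@perm_inj _ s)) /=.
by apply: eq_bigr => y _; case: (s y \in B).
Qed.

Lemma avg_at (x : 'I_n) : avg (fun s : 'S_n => b (s x)) = beta.
Proof.
have n0 : n%:R != 0 :> R by rewrite pnatr_eq0 -lt0n; case: (n) x => [[]|].
apply: (mulIf n0); rewrite /beta mulfVK //.
have E (y : 'I_n) : avg (fun s : 'S_n => b (s y)) = avg (fun s : 'S_n => b (s x)).
  rewrite -[RHS](avg_perm _ (mulgI (tperm x y))); apply: eq_avg => s.
  by rewrite permM tpermL.
have : \sum_(y : 'I_n) avg (fun s : 'S_n => b (s y)) = #|B|%:R.
  by rewrite -avg_sum (eq_avg sum_mem_perm) (avg_cst (card_perm_gt0 n)).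
by rewrite (eq_bigr _ (fun y _ => E y)) sumr_const card_ord -[avg _ *+ n]mulr_natr.
Qed.

(** Sampling without replacement: once [x] carries a value in [B], only [#|B| - 1] of the other
    [n - 1] values are in [B], and this ratio is at most [#|B| / n]. *)
Lemma avg_at2 (x y : 'I_n) : x != y ->
  avg (fun s : 'S_n => b (s x) * b (s y)) <= beta ^+ 2.
Proof.
move=> xy.
have n1 : (1 < n)%N.
  rewrite ltnNge; apply: contraNN xy => n1; apply/eqP/val_inj => /=.
  by have := ltn_ord x; have := ltn_ord y; lia.
have E (z : 'I_n) : z != x -> avg (fun s : 'S_n => b (s x) * b (s z)) =
    avg (fun s : 'S_n => b (s x) * b (s y)).
  move=> zx; rewrite -[RHS](avg_perm _ (mulgI (tperm z y))); apply: eq_avg => s.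
  by rewrite !permM tpermR tpermD // eq_sym.
have S1 : \sum_(z | z != x) avg (fun s : 'S_n => b (s x) * b (s z)) =
    beta * (#|B|%:R - 1).
  rewrite -avg_sum -(avg_at x) [RHS]mulrC -avgZ; apply: eq_avg => s.
  rewrite -mulr_sumr.
  have := sum_mem_perm s; rewrite (bigD1 x) //= => <-.
  by case: (s x \in B); rewrite ?mul0r ?mulr0 // mul1r mulr1 addrAC subrr add0r.
move: S1; rewrite (eq_bigr _ (fun z zx => E z zx)) sumr_const.
have -> : #|[pred z | z != x]| = n.-1.
  by rewrite -[n in RHS]card_ord [in RHS](cardD1 x) inE; apply: eq_card => z; rewrite !inE andbT.
set p := avg _ => S1.
have nR : n.-1%:R = n%:R - 1 :> R by rewrite -subn1 natrB // ltnW.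
rewrite -[p *+ n.-1]mulr_natr nR in S1.
have n1' : 1 < n%:R :> R by rewrite ltr1n.
have Bn : #|B|%:R <= n%:R :> R by rewrite ler_nat -[n in leqRHS]card_ord max_card.
have nn0 : n%:R != 0 :> R by rewrite gt_eqF //; lra.
have beta0 : 0 <= beta by rewrite divr_ge0.
have bn : beta * n%:R = #|B|%:R by rewrite /beta mulfVK.
have n10 : 0 < n%:R - 1 :> R by lra.
rewrite -(ler_pM2r n10) S1 -bn expr2 -[leRHS]mulrA; apply: ler_wpM2l => //.
rewrite -bn in Bn; rewrite mulrBr mulr1 lerB //.
by rewrite ler_pdivrMr ?mul1r //; lra.
Qed.

(** By [avg_at2] the off-diagonal covariances are nonpositive, and each diagonal term is at most
    1. *)
Lemma top_sum_var (W : {set 'I_n}) :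
  avg (fun s : 'S_n => (\sum_(x in W) (b (s x) - beta)) ^+ 2) <= #|W|%:R.
Proof.
have E (s : 'S_n) : (\sum_(x in W) (b (s x) - beta)) ^+ 2 =
    \sum_(x in W) \sum_(y in W) (b (s x) - beta) * (b (s y) - beta).
  by rewrite expr2 big_distrlr.
rewrite (eq_avg E) avg_sum -sumr_const; apply: ler_sum => x xW.
rewrite avg_sum (bigD1 x) //= -[leRHS]addr0 lerD //.
  rewrite -[leRHS](avg_cst (card_perm_gt0 n)); apply: ler_avg => s.
  have : 0 <= beta <= 1.
    rewrite divr_ge0 //= ler_pdivrMr ?mul1r ?ler_nat; last first.
      by rewrite ltr0n; case: (n) x {xW} => [[]|].
    by rewrite -[n in leqRHS]card_ord max_card.
  by case: (s x \in B); rewrite /=; nra.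
apply: sumr_le0 => y /andP[yW yx].
have E2 (s : 'S_n) : (b (s x) - beta) * (b (s y) - beta) =
  b (s x) * b (s y) - beta * b (s x) - beta * b (s y) + beta ^+ 2 by ring.
rewrite (eq_avg E2) avgD !avgB !avgZ !avg_at (avg_cst (card_perm_gt0 n)).
rewrite eq_sym in yx; have h := avg_at2 yx; rewrite -subr_le0 in h.
apply: le_trans h; rewrite -/beta le_eqVlt; apply/orP; left; apply/eqP.
by set p := avg _; ring.
Qed.

End TopValues.

(** * Covariance of the count with the top values in a segment *)

Section OccVar.
Variables (R : realType) (k n : nat) (pi : 'S_k) (A : {set 'I_k.-1}).
Local Notation valid := (@valid k n A).
Local Notation ind i s := ((matches pi s i)%:R : R).

Lemma occ_countE (s : 'S_n) : occ_count R pi A s = \sum_(i | valid i) ind i s.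
Proof.
rewrite /occ_count /occurrences -sum1_card natr_sum big_mkcond [RHS]big_mkcond /=.
apply: eq_bigr => i _; rewrite inE /is_occurrence /valid -/(matches pi s i).
case: [forall r, _] => //=; case: (matches pi s i) => //=; last by rewrite if_same.
Qed.

Lemma matches_order (i : {ffun 'I_k -> 'I_n}) : order_on (imset_of i) (fun s => ind i s).
Proof.
move=> s s' ss'; congr (_%:R); congr (nat_of_bool _).
apply: eq_forallb => r; apply: eq_forallb => t.
by rewrite ss' // imset_f.
Qed.

(** Sending [i r] to [i (pi r)] and fixing all other positions works, because [i] is increasing. *)
Lemma exists_matching (i : {ffun 'I_k -> 'I_n}) : valid i ->
  exists s : 'S_n, matches pi s i.
Proof.
move=> vi; pose f x := if [pick r | i r == x] is Some r then i (pi r) else x.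
have fi r : f (i r) = i (pi r).
  rewrite /f; case: pickP => [t /eqP /(valid_inj vi) -> //|/(_ r)].
  by rewrite eqxx.
have fo x : (forall r, i r != x) -> f x = x.
  by move=> h; rewrite /f; case: pickP => [r|//]; rewrite (negbTE (h r)).
have dec x : (exists r, x = i r) \/ (forall r, i r != x).
  case: (pickP (fun r => i r == x)) => [r /eqP <-|h]; first by left; exists r.
  by right => r; rewrite h.
have finj : injective f.
  move=> x y; case: (dec x) => [[r ->]|hx]; case: (dec y) => [[t ->]|hy].
  - by rewrite !fi => /(valid_inj vi) /perm_inj ->.
  - by rewrite fi fo // => h; have := hy (pi r); rewrite h eqxx.
  - by rewrite fi fo // => h; have := hx (pi t); rewrite -h eqxx.
  - by rewrite !fo.
exists (perm finj); apply/forallP => r; apply/forallP => t; rewrite !permE !fi.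
apply/eqP; apply/idP/idP; first exact: (valid_lt vi).
by apply: contraTT; rewrite -!leqNgt; exact: (valid_le vi).
Qed.

Lemma exists_matching_from (i : {ffun 'I_k -> 'I_n}) (s : 'S_n) : valid i ->
  exists2 h, perm_on (imset_of i) h & matches pi (h * s)%g i.
Proof.
move=> vi; have [s' s'i] := exists_matching vi.
have [h hi hs] := perm_align (imset_of i) s s'.
exists h => //; apply/forallP => r; apply/forallP => t.
by move/forallP/(_ r)/forallP/(_ t): s'i; rewrite !permM hs // imset_f.
Qed.

Lemma card_imset_of (i : {ffun 'I_k -> 'I_n}) : valid i -> #|imset_of i| = k.
Proof. by move=> vi; rewrite card_imset ?card_ord //; exact: valid_inj vi. Qed.

Lemma avg_matches_ge (i : {ffun 'I_k -> 'I_n}) : valid i ->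
  (k`!)%:R^-1 <= avg (fun s => ind i s).
Proof.
move=> vi; have [s si] := exists_matching vi.
rewrite -{1}(card_imset_of vi); apply: (avg_order_ge (s0 := s)).
- exact: matches_order.
- by move=> t; exact: ler0n.
- by rewrite si.
Qed.

Variables (rmax e : 'I_k) (q : nat) (W : {set 'I_n}).
Hypothesis pimax : pi rmax = k.-1 :> nat.
Hypothesis ermax : e != rmax.
Hypothesis qn : (q <= n)%N.
Let B : {set 'I_n} := [set v : 'I_n | (n - q <= v)%N].
Let beta : R := q%:R / n%:R.
Hypothesis beta_small : beta <= (2 * (k`!)%:R)^-1.
Let T (s : 'S_n) : R := \sum_(x in W) ((s x \in B)%:R - beta).

(* If the entry at an index other than [rmax] is a top value, so is the entry at [rmax],
   and two given positions carry top values with probability at most [beta ^ 2]. *)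
Lemma cov_top (i : {ffun 'I_k -> 'I_n}) (x : 'I_n) : valid i ->
  avg (fun s => ind i s * ((s x \in B)%:R - beta)) <=
  - (beta / (2 * (k`!)%:R)) * (x == i e)%:R + beta * (x == i rmax)%:R.
Proof.
move=> vi.
have beta0 : 0 <= beta by rewrite divr_ge0.
have avgB1 (y : 'I_n) : avg (fun s : 'S_n => (s y \in B)%:R : R) = beta.
  by rewrite avg_at (card_top qn).
have F0 : 0 < (k`!)%:R :> R by rewrite ltr0n fact_gt0.
have [xi|xi] := boolP (x \in imset_of i); last first.
  have ne r : (x == i r) = false.
    by apply/negP => /eqP xr; rewrite xr imset_f in xi.
  rewrite !ne !mulr0 addr0 (avg_indep (@matches_order i)); last first.
    by move=> s s' ss'; rewrite ss' // inE.
  by rewrite avgB avgB1 (avg_cst (card_perm_gt0 n)) subrr mulr0.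
have /imsetP[r _ xr] := xi.
have [rm|rm] := eqVneq r rmax.
  have -> : (x == i e) = false.
    apply/negP; rewrite xr rm => /eqP /(valid_inj vi) h.
    by move: ermax; rewrite h eqxx.
  rewrite xr rm eqxx mulr0 mulr1 add0r -{2}(avgB1 (i rmax)); apply: ler_avg => s.
  by case: (matches pi s i); case: (_ \in B); rewrite /=; lra.
have -> : (x == i rmax) = false.
  by apply/negP; rewrite xr => /eqP /(valid_inj vi) h; rewrite h eqxx in rm.
have xne : x != i rmax.
  by apply/negP; rewrite xr => /eqP /(valid_inj vi) h; rewrite h eqxx in rm.
(* As [beta <= 1 / (2 k!)], this quantity is at most [- beta / (2 k!)], which settles [x = i e], and
   it is at most 0, which settles the remaining entries. *)
apply: (@le_trans _ _ (beta ^+ 2 - beta * (k`!)%:R^-1)).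
  have E s : ind i s * ((s x \in B)%:R - beta) =
     ind i s * (s x \in B)%:R - beta * ind i s by ring.
  rewrite (eq_avg E) avgB avgZ lerB //; last by rewrite ler_wpM2l // avg_matches_ge.
  have := @avg_at2 R n B x (i rmax) xne; rewrite (card_top qn); apply: le_trans.
  apply: ler_avg => s; have [m|_] := boolP (matches pi s i); last by rewrite mul0r mulr_ge0.
  rewrite mul1r; have [sB|_] := boolP (s x \in B); last by rewrite mul0r.
  rewrite mul1r ler1n lt0b inE.
  move: sB; rewrite inE => sB; apply: leq_trans sB _; apply: ltnW.
  move/forallP/(_ r)/forallP/(_ rmax)/eqP: m; rewrite xr => <-.
  have : pi r != pi rmax by rewrite (inj_eq perm_inj).
  rewrite -val_eqE /= pimax; have := ltn_ord (pi r); lia.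
have -> : beta ^+ 2 - beta * (k`!)%:R^-1 = - (beta / (2 * (k`!)%:R)) -
   beta * ((2 * (k`!)%:R)^-1 - beta) by field; rewrite gt_eqF.
have h1 : 0 <= beta * ((2 * (k`!)%:R)^-1 - beta) by rewrite mulr_ge0 // subr_ge0.
have h2 : 0 <= beta / (2 * (k`!)%:R) by rewrite divr_ge0 // mulr_ge0 // ltW.
by case: (x == i e); rewrite /= ?mulr1 ?mulr0; lra.
Qed.

Let X (s : 'S_n) : R := occ_count R pi A s.
Let Lc : nat := #|[set i | valid i & i e \in W]|.
Let Uc : nat := #|[set i | valid i & i rmax \in W]|.

(** Summing [cov_top] over [W], each vector counted by [Lc] adds at most [- beta / (2 k!)] to the
    covariance of [X] and [T], and each one counted by [Uc] at most [beta]; Cauchy-Schwarz and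
    [top_sum_var] conclude. *)
Lemma var_lower : 0 <= Lc%:R / (2 * (k`!)%:R) - Uc%:R :> R ->
  (beta * (Lc%:R / (2 * (k`!)%:R) - Uc%:R)) ^+ 2 <=
  avg (fun s => (X s - avg X) ^+ 2) * #|W|%:R.
Proof.
move=> h0.
have beta0 : 0 <= beta by rewrite divr_ge0.
have avgT : avg T = 0.
  rewrite avg_sum big1 // => x _.
  by rewrite avgB avg_at (card_top qn) (avg_cst (card_perm_gt0 n)) subrr.
have XT : avg (fun s => X s * T s) <= - (beta * (Lc%:R / (2 * (k`!)%:R) - Uc%:R)).
  have E s : X s * T s =
      \sum_(i | valid i) \sum_(x in W) ind i s * ((s x \in B)%:R - beta).
    by rewrite /X occ_countE mulr_suml; apply: eq_bigr => i _; rewrite mulr_sumr.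
  rewrite (eq_avg E) avg_sum.
  apply: (@le_trans _ _ (\sum_(i | valid i) \sum_(x in W)
     (- (beta / (2 * (k`!)%:R)) * (x == i e)%:R + beta * (x == i rmax)%:R))).
    apply: ler_sum => i vi; rewrite avg_sum; apply: ler_sum => x xW.
    exact: cov_top.
  have cnt (r : 'I_k) : \sum_(i | valid i) \sum_(x in W) (x == i r)%:R =
      #|[set i | valid i & i r \in W]|%:R :> R.
    rewrite -sumr_const [RHS](eq_bigl (fun i => valid i && (i r \in W))); last first.
      by move=> i; rewrite inE.
    rewrite [RHS]big_mkcondr /=; apply: eq_bigr => i _.
    have [iW|iW] := boolP (i r \in W).
      rewrite (bigD1 (i r)) //= eqxx big1 ?addr0 // => x /andP[_ /negbTE ->].
      by [].
    rewrite big1 // => x xW; case: eqP => // h; by rewrite -h xW in iW.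
  have E3 : \sum_(i | valid i) \sum_(x in W)
     (- (beta / (2 * (k`!)%:R)) * (x == i e)%:R + beta * (x == i rmax)%:R) =
     - (beta / (2 * (k`!)%:R)) * Lc%:R + beta * Uc%:R.
    rewrite /Lc /Uc -!cnt !mulr_sumr -big_split; apply: eq_bigr => i _ /=.
    by rewrite !mulr_sumr -big_split.
  by rewrite E3 le_eqVlt; apply/orP; left; apply/eqP; ring.
have cs := avg_cauchy_schwarz (fun s => X s - avg X) T.
have E4 : avg (fun s => (X s - avg X) * T s) = avg (fun s => X s * T s).
  have E5 s : (X s - avg X) * T s = X s * T s - avg X * T s by ring.
  by rewrite (eq_avg E5) avgB avgZ avgT mulr0 subr0.
rewrite E4 in cs.
have TW : avg (fun s => T s ^+ 2) <= #|W|%:R.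
  by have := @top_sum_var R n B W; rewrite (card_top qn).
have V0 : 0 <= avg (fun s => (X s - avg X) ^+ 2) by apply: avg_ge0 => s; exact: sqr_ge0.
apply: le_trans (le_trans cs _); last by rewrite ler_wpM2l.
rewrite -[leRHS]sqrrN ler_sqr ?nnegrE; [lra | by rewrite mulr_ge0 | ].
have : 0 <= beta * (Lc%:R / (2 * (k`!)%:R) - Uc%:R) by rewrite mulr_ge0.
lra.
Qed.

End OccVar.

Definition occ_var (R : realType) (k n : nat) (pi : 'S_k) (A : {set 'I_k.-1}) : R :=
  avg (fun s : 'S_n => (occ_count R pi A s - avg (occ_count R pi A (n := n))) ^+ 2).

Lemma divn_half d n : (0 < d <= n)%N -> (n <= 2 * d * (n %/ d))%N.
Proof.
move=> /andP[d0 dn]; have := divn_eq n d; have := ltn_pmod n d0.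
have : (0 < n %/ d)%N by rewrite divn_gt0.
nia.
Qed.

Lemma block_end_le c k M m n : (c < k)%N -> (4 * k * M <= n)%N ->
  (128 * k * k <= n)%N -> (128 * m <= n)%N -> (c * (M + k) + (M + k) + m + k <= n)%N.
Proof.
move=> ck kM kk mn; have h : (c * (M + k) + (M + k) <= k * (M + k))%N.
  by rewrite addnC -mulSn leq_mul2r ck orbT.
have k1 : (k <= k * k)%N by rewrite leq_pmulr //; lia.
rewrite mulnDr in h; lia.
Qed.

(** * Variance with at least two blocks *)

Section VarMulti.
Variables (R : realType) (k : nat) (pi : 'S_k) (A : {set 'I_k.-1}).
Hypothesis k2 : (2 <= k)%N.
Local Notation starts := (starts A).
Local Notation bs := (@bs k A).
Hypothesis j2 : (1 < #|starts|)%N.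

(** [g] is the loss in replacing [M ^ J.+1] by [n ^ J.+1] when [n <= 8 k M]. [K] is chosen so that
    [m K <= n] turns the upper count [4 m^2 n^J] into at most half of the lower count
    [m n^(J+1) / g] divided by [2 f]. *)
Let f := k`!.
Let J := #|starts|.-2.
Let g := ((8 * k) ^ J.+1)%N.
Let K := (16 * f * g)%N.

Lemma kfact_gt0 : (0 < f)%N. Proof. exact: fact_gt0. Qed.

Lemma slack_ge : (8 * k <= g)%N.
Proof. by rewrite /g expnS leq_pmulr // expn_gt0; apply/orP; left; lia. Qed.

Lemma scale_ge : (128 * k <= K)%N.
Proof. by rewrite /K; have := kfact_gt0; have := slack_ge; nia. Qed.

Lemma slack_gt0 : (0 < g)%N. Proof. by apply: leq_trans slack_ge; rewrite muln_gt0 /= ltnW. Qed.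

Lemma starts_card : #|starts| = J.+2. Proof. by rewrite /J; lia. Qed.

Lemma two_mul_add3 a : (2 * a + 3 = a.+1 * 2 + 1)%N. Proof. lia. Qed.

Section FixN.
Variable n : nat.
Hypothesis nK : (k * K <= n)%N.
(* [m] is the length of an end segment of positions, [M] the room given to the start of
   each of the other blocks. *)
Let m := (n %/ K)%N.
Let M := (n %/ (4 * k))%N.

Lemma scale_gt0 : (0 < K)%N. Proof. by apply: leq_trans scale_ge; rewrite muln_gt0 /= ltnW. Qed.
Lemma scale_le : (K <= n)%N. Proof. by apply: leq_trans nK; rewrite leq_pmull // ltnW. Qed.
Lemma edge_scale_le : (m * K <= n)%N. Proof. exact: leq_divM. Qed.
Lemma edge_ge : (n <= 2 * K * m)%N.
Proof. by apply: divn_half; rewrite scale_gt0 scale_le. Qed.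
Lemma k_le_edge : (k <= m)%N.
Proof. by rewrite leq_divRL // scale_gt0. Qed.
Lemma four_k_le : (4 * k <= K)%N.
Proof. by apply: leq_trans scale_ge; rewrite leq_mul2r orbT. Qed.
Lemma room_le : (4 * k * M <= n)%N. Proof. by rewrite mulnC; exact: leq_divM. Qed.
Lemma room_ge : (n <= 8 * k * M)%N.
Proof.
have -> : (8 * k = 2 * (4 * k))%N by rewrite mulnA.
by apply: divn_half; rewrite muln_gt0 /= ltnW //= (leq_trans four_k_le scale_le).
Qed.
Lemma edge_le_room : (m <= M)%N.
Proof. by apply: leq_div2l four_k_le; rewrite muln_gt0 /= ltnW. Qed.
Lemma k_sqr_le : (128 * k * k <= n)%N.
Proof. by apply: leq_trans nK; rewrite mulnC leq_mul2l scale_ge orbT. Qed.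
Lemma edge_small : (128 * m <= n)%N.
Proof.
apply: leq_trans edge_scale_le; rewrite mulnC leq_mul2l; apply/orP; right.
by apply: leq_trans scale_ge; rewrite leq_pmulr // ltnW.
Qed.

Lemma edge_gt0 : (0 < m)%N. Proof. by apply: leq_trans k_le_edge; exact: ltnW. Qed.
Lemma n_gt0 : (0 < n)%N. Proof. exact: leq_trans scale_gt0 scale_le. Qed.
Lemma kfact_le : (0 < 2 * f <= n)%N.
Proof. by have := scale_le; have := kfact_gt0; have := slack_gt0; rewrite /K; nia. Qed.

Lemma prod_two (L : 'I_k -> nat) (e : 'I_k) : e \in starts ->
  L e = m -> (forall c, c != e -> L c = M) ->
  (\prod_(c in starts) L c = m * M ^ J.+1)%N.
Proof.
move=> eS Le LM; rewrite (bigD1 e) //= Le (eq_bigr (fun _ => M)); last first.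
  by move=> c /andP[_ ce]; exact: LM.
rewrite prod_nat_const; congr (_ * _ ^ _)%N.
have := cardsD1 e starts; rewrite eS starts_card add1n => -[->].
by apply: eq_card => c; rewrite in_setD1 andbC.
Qed.

(* [W] is an end segment of positions and [e] the extreme index at that end. *)
Lemma edge_counts (e : 'I_k) (W : {set 'I_n}) (rmax : 'I_k) (off : 'I_k -> nat) :
  bs rmax != bs e ->
  (forall i, valid A i -> i rmax \in W -> i e \in W) ->
  (forall i, valid A i -> (off (bs e) <= i (bs e) < off (bs e) + m)%N -> i e \in W) ->
  (#|W| <= 2 * m)%N ->
  {in starts &, forall c c' : 'I_k, (c < c')%N ->
    (off c + (if c == bs e then m else M) + k <= off c')%N} ->
  {in starts, forall c : 'I_k, (off c + (if c == bs e then m else M) + k <= n)%N} ->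
  (m * M ^ J.+1 <= #|[set i | @valid k n A i & i e \in W]|)%N /\
  (#|[set i | @valid k n A i & i rmax \in W]| <= (2 * m) ^ 2 * n ^ J)%N.
Proof.
move=> re HW HW2 Wm offS offn; split.
  pose L c := if c == bs e then m else M.
  rewrite -(@prod_two L (bs e)) ?bs_in //; last 2 first.
  - by rewrite /L eqxx.
  - by move=> c; rewrite /L => /negbTE ->.
  apply: leq_trans (card_valid_ge _ offS offn) _; first lia.
  apply: subset_leq_card; apply/fintype.subsetP => i; rewrite !inE => /andP[vi /forallP h].
  rewrite vi /=; apply: HW2 => //.
  by have := h (bs e); rewrite bs_in eqxx.
apply: (@leq_trans (#|W| ^ 2 * n ^ J)); last by rewrite leq_mul2r leq_exp2r // Wm orbT.
have := card_valid_at2 W re; rewrite starts_card /=; apply: leq_trans.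
apply: subset_leq_card; apply/fintype.subsetP => i; rewrite !inE => /andP[vi iW].
by rewrite vi iW HW.
Qed.

Lemma var_arith (W : {set 'I_n}) (e rmax : 'I_k) : (0 < #|W| <= 2 * m)%N ->
  pi rmax = k.-1 :> nat -> e != rmax ->
  (m * M ^ J.+1 <= #|[set i | @valid k n A i & i e \in W]|)%N ->
  (#|[set i | @valid k n A i & i rmax \in W]| <= (2 * m) ^ 2 * n ^ J)%N ->
  n%:R ^+ (2 * J + 3) / (32 * f%:R * g%:R * (2 ^+ 9 * f%:R ^+ 4 * g%:R ^+ 2)) <= occ_var R n pi A.
Proof.
move=> /andP[W0 Wm] pim erm Lc Uc.
(* This number of top values puts [beta = q / n] between [1 / (4 k!)] and [1 / (2 k!)]. *)
set q := (n %/ (2 * f))%N.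
have f0 := kfact_gt0; have g0 := slack_gt0.
have q1 : (q * (2 * f) <= n)%N by exact: leq_divM.
have q2 : (n <= 4 * f * q)%N.
  have -> : (4 * f = 2 * (2 * f))%N by rewrite mulnA.
  exact: divn_half kfact_le.
have n0 := n_gt0.
pose fR : R := f%:R; pose gR : R := g%:R; pose nR : R := n%:R; pose mR : R := m%:R.
have f0R : 0 < fR by rewrite ltr0n.
have g0R : 0 < gR by rewrite ltr0n.
have n0R : 0 < nR by rewrite ltr0n.
have m0R : 0 < mR by rewrite ltr0n edge_gt0.
have fn0 : fR != 0 by rewrite gt_eqF.
have gn0 : gR != 0 by rewrite gt_eqF.
have nn0 : nR != 0 by rewrite gt_eqF.
have betaE : q%:R / nR <= (2 * fR)^-1.
  rewrite ler_pdivrMr // -[leRHS]mulrC ler_pdivlMr ?mulr_gt0 //.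
  by rewrite -natrM -natrM ler_nat.
have beta2 : (4 * fR)^-1 <= q%:R / nR.
  rewrite ler_pdivlMr // mulrC ler_pdivrMr ?mulr_gt0 //.
  by rewrite mulrC -!natrM ler_nat.
have qn : (q <= n)%N by apply: leq_trans q1; rewrite leq_pmulr // muln_gt0.
set LcN := #|_| in Lc; set UcN := #|_| in Uc.
(* [G] is half of the lower bound for [Lc / (2 f)] and at the same time an upper bound for [Uc]. The
   variance is then at least [(G / (4 f))^2 / (2 m)], of order [n^(2J+3)] since [m] is proportional
   to [n]. *)
pose G := mR * nR ^+ J.+1 / (4 * fR * gR).
have G0 : 0 < G by rewrite divr_gt0 ?mulr_gt0 ?exprn_gt0.
have LG : mR * nR ^+ J.+1 / gR <= LcN%:R.
  rewrite ler_pdivrMr //; apply: (@le_trans _ _ ((m * M ^ J.+1) * g)%N%:R); last first.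
    by rewrite -natrM ler_nat leq_mul2r Lc orbT.
  rewrite -natrX -natrM ler_nat -mulnA leq_mul2l; apply/orP; right.
  by rewrite /g -expnMn leq_exp2r // mulnC room_ge.
have UG : UcN%:R <= mR * nR ^+ J.+1 / (4 * fR * gR).
  rewrite ler_pdivlMr ?mulr_gt0 //.
  rewrite -natrX -!natrM ler_nat.
  apply: (@leq_trans ((2 * m) ^ 2 * n ^ J * (4 * f * g))); first by rewrite leq_mul2r Uc orbT.
  have -> : ((2 * m) ^ 2 * n ^ J * (4 * f * g) = m * n ^ J * (m * K))%N by rewrite /K; ring.
  by rewrite expnSr [leqRHS]mulnA leq_mul2l edge_scale_le orbT.
have diff : G <= LcN%:R / (2 * fR) - UcN%:R.
  have : 2 * G <= LcN%:R / (2 * fR).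
    rewrite ler_pdivlMr ?mulr_gt0 //.
    by have -> : 2 * G * (2 * fR) = mR * nR ^+ J.+1 / gR by rewrite /G; field; rewrite gn0.
  rewrite -/G in UG; lra.
have := @var_lower R k n pi A rmax e q W pim erm qn betaE (le_trans (ltW G0) diff).
rewrite -/(occ_var R n pi A) -/LcN -/UcN => VW.
have b0 : 0 < (4 * fR)^-1 by rewrite invr_gt0 mulr_gt0.
have V0 : 0 <= occ_var R n pi A by apply: avg_ge0 => s; exact: sqr_ge0.
have : ((4 * fR)^-1 * G) ^+ 2 <= occ_var R n pi A * (2 * mR).
  apply: le_trans (le_trans _ VW) _.
    rewrite ler_sqr ?nnegrE; last 2 first.
    - by rewrite mulr_ge0 // ltW.
    - by rewrite mulr_ge0 ?divr_ge0 // (le_trans (ltW G0) diff).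
    by rewrite ler_pM // ltW.
  by rewrite ler_wpM2l // -natrM ler_nat.
rewrite -ler_pdivrMr ?mulr_gt0 //; apply: le_trans.
have nmR : nR <= 32 * fR * gR * mR.
  rewrite -!natrM ler_nat; have := edge_ge; rewrite /K.
  by have -> : (2 * (16 * f * g) * m = 32 * f * g * m)%N by ring.
have d1 : 0 < 32 * fR * gR by rewrite !mulr_gt0.
have d2 : 0 < 2 ^+ 9 * fR ^+ 4 * gR ^+ 2 by rewrite !mulr_gt0 ?exprn_gt0.
have -> : ((4 * fR)^-1 * G) ^+ 2 / (2 * mR) =
   (nR ^+ J.+1) ^+ 2 * mR / (2 ^+ 9 * fR ^+ 4 * gR ^+ 2).
  by rewrite /G; field; rewrite fn0 gn0 gt_eqF.
rewrite two_mul_add3 exprD exprM expr1 -/nR -/fR -/gR.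
rewrite invfM mulrA ler_wpM2r ?invr_ge0 ?(ltW d2) //.
rewrite ler_pdivrMr // -[leRHS]mulrA; apply: ler_wpM2l; first exact: sqr_ge0.
by rewrite mulrC.
Qed.

Lemma starts_le_last (last c : 'I_k) : last = k.-1 :> nat -> c \in starts -> (c <= bs last)%N.
Proof.
move=> lE; rewrite inE => /eqP cS; rewrite leqNgt; apply/negP => h.
have : bs c = bs last.
  apply: val_inj; rewrite /= (bstart_between (m := last)) //.
  by rewrite (ltnW h) lE -ltnS prednK ?ltn_ord // ltnW.
by move=> E; move: h; rewrite -E cS ltnn.
Qed.

Lemma ord_off (c c' : 'I_k) : (c < c')%N -> (c * (M + k) + (M + k) <= c' * (M + k))%N.
Proof. by move=> cc; rewrite addnC -mulSn leq_mul2r cc orbT. Qed.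

Lemma kM_bound (c : 'I_k) : (c * (M + k) + (M + k) + m + k <= n)%N.
Proof.
exact: block_end_le (ltn_ord c) room_le k_sqr_le edge_small.
Qed.

Lemma var_fixn : n%:R ^+ (2 * J + 3) / (32 * f%:R * g%:R * (2 ^+ 9 * f%:R ^+ 4 * g%:R ^+ 2)) <= occ_var R n pi A.
Proof.
have k0 : (0 < k)%N by lia.
pose r0 : 'I_k := Ordinal k0.
have kl : (k.-1 < k)%N by lia.
pose last : 'I_k := Ordinal kl.
pose rmax : 'I_k := (pi^-1)%g last.
have pim : pi rmax = k.-1 :> nat by rewrite /rmax permKV.
have mn := edge_le_room; have kmn := k_le_edge; have m8 := edge_small.
have [b0|b0] := eqVneq (bs rmax) (bs r0); last first.
  have m0n : (m <= n)%N by lia.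
  pose W : {set 'I_n} := [set x : 'I_n | (x < m)%N]%SET.
  have Wm : #|W| = m.
    have wi : injective (widen_ord m0n) by move=> x y /(congr1 val) /= /val_inj.
    rewrite -[RHS]card_ord -(fintype.card_image wi); apply: eq_card => v; rewrite inE.
    apply/idP/fintype.imageP => [vm|[x _ ->]]; last exact: (ltn_ord x).
    by exists (Ordinal vm) => //; apply: val_inj.
  have bs0 : bs r0 = r0 by apply: val_inj.
  have [|||||Lc Uc] := @edge_counts r0 W rmax (fun c => c * (M + k))%N b0.
  - by move=> i vi; rewrite !inE; apply: leq_ltn_trans; exact: (@valid_le _ _ _ i r0 rmax vi (leq0n _)).
  - by move=> i vi; rewrite bs0 inE /= mul0n.
  - by rewrite Wm; lia.
  - by move=> c c' _ _ /ord_off; case: ifP => _; lia.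
  - by move=> c _; have := kM_bound c; case: ifP => _; lia.
  apply: (var_arith (e := r0) (rmax := rmax) (W := W)) => //.
    by rewrite Wm edge_gt0 leq_pmull.
  by apply: contraNneq b0 => ->.
(* The maximum lies in the first block; since there are at least two blocks, it is not in the last
   one. *)
have bl : bs rmax != bs last.
  rewrite b0; apply/eqP => b1.
  have : (#|starts| <= 1)%N.
    rewrite -(cards1 r0); apply: subset_leq_card; apply/fintype.subsetP => c cS.
    have := starts_le_last (last := last) erefl cS; rewrite -b1 /= leqn0 => /eqP c0.
    by rewrite inE; apply/eqP/val_inj.
  by have := j2; lia.
have mkn : (m + k <= n)%N by lia.
(* The extra [k] positions hold the last block itself when it starts at one of the first [m]
   positions of the segment. *)
pose W : {set 'I_n} := [set x : 'I_n | (n - (m + k) <= x)%N]%SET.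
have Wm : #|W| = (m + k)%N by exact: (card_top mkn).
pose off (c : 'I_k) := if c == bs last then (n - (m + k))%N else (c * (M + k))%N.
have [|||||Lc Uc] := @edge_counts last W rmax off bl.
- move=> i vi; rewrite !inE => h; apply: leq_trans h _; apply: (valid_le vi) => /=.
  by rewrite -ltnS prednK.
- move=> i vi; rewrite /off eqxx inE => /andP[h _]; apply: leq_trans h _.
  by apply: (valid_le vi) => /=; exact: bstart_le.
- by rewrite Wm; lia.
- move=> c c' cS cS' cc; rewrite /off.
  have [cl|cl] := eqVneq c (bs last).
    by have := starts_le_last (last := last) erefl cS'; rewrite -cl; lia.
  have [cl'|cl'] := eqVneq c' (bs last); last by have := ord_off cc; lia.
  by have := kM_bound c; lia.
- move=> c cS; rewrite /off; case: ifP => _; first lia.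
  by have := kM_bound c; lia.
apply: (var_arith (e := last) (rmax := rmax) (W := W)) => //.
  by rewrite Wm addn_gt0 edge_gt0 mul2n -addnn leq_add2l k_le_edge.
by apply: contraNneq bl => ->.
Qed.

End FixN.

Lemma var_ge_multi : exists2 c : R, 0 < c & exists n1, forall n, (n1 <= n)%N ->
  c * n%:R ^+ (2 * #|starts| - 1) <= occ_var R n pi A.
Proof.
have f0 := kfact_gt0; have g0 := slack_gt0.
exists (32 * f%:R * g%:R * (2 ^+ 9 * f%:R ^+ 4 * g%:R ^+ 2))^-1.
  by rewrite invr_gt0 !mulr_gt0 ?exprn_gt0 ?ltr0n.
exists (k * K)%N => n nK; rewrite mulrC.
have -> : (2 * #|starts| - 1 = 2 * J + 3)%N by rewrite starts_card; lia.
exact: var_fixn.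
Qed.

End VarMulti.

(** * Variance from orthogonal local terms *)

Section BlockVariance.
Variables (R : realType) (n N : nat) (X : 'S_n -> R) (U : 'I_N -> {set 'I_n}).
Local Notation H w := (fun h : 'S_n => perm_on (U w) h).
(** This is [c] times the deviation of [X] from its mean over rearrangements of the values on [U w];
    leaving out the division keeps it a plain sum. *)
Let D (w : 'I_N) (s : 'S_n) : R := \sum_(h | H w h) (X s - X (h * s)%g).
Variables (c d : R).
Hypothesis cardH : forall w, #|[pred h | H w h]|%:R = c.
Hypothesis D_inv : forall w w', w' != w -> forall h s, H w' h -> D w (h * s)%g = D w s.
Hypothesis Dd : forall w, d <= avg (fun s => D w s ^+ 2).

Lemma sum_orbit_inv w h (F : 'S_n -> R) s : H w h ->
  \sum_(h' | H w h') F (h' * (h * s))%g = \sum_(h' | H w h') F (h' * s)%g.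
Proof.
move=> hH; rewrite [RHS](reindex_inj (mulIg h)) /=.
apply: eq_big => [h'|h' _]; last by rewrite mulgA.
apply/idP/idP => h'H; first exact: perm_onM.
by rewrite -[h'](mulgK h); apply: perm_onM => //; exact: perm_onV.
Qed.

Lemma sum_cst_H w (x : R) : \sum_(h | H w h) x = c * x.
Proof. by rewrite sumr_const -(cardH w) mulr_natl. Qed.

Lemma D_alt w s : D w s = c * X s - \sum_(h | H w h) X (h * s)%g.
Proof. by rewrite /D sumrB sum_cst_H. Qed.

Lemma c_gt0 (w : 'I_N) : 0 < c.
Proof. by rewrite -(cardH w); exact: perm_on_gt0. Qed.

Lemma sum_D w s : \sum_(h | H w h) D w (h * s)%g = 0.
Proof.
rewrite (eq_bigr (fun h => c * X (h * s)%g - \sum_(h' | H w h') X (h' * s)%g)); last first.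
  by move=> h hH; rewrite D_alt sum_orbit_inv.
by rewrite sumrB -mulr_sumr sum_cst_H subrr.
Qed.

(** [D w] sums to zero over each orbit of the permutations supported on [U w], hence is orthogonal
    to every function constant on these orbits. *)
Lemma D_orth w (G : 'S_n -> R) : (forall h s, H w h -> G (h * s)%g = G s) ->
  avg (fun s => D w s * G s) = 0.
Proof.
move=> Gi; have c0 := c_gt0 w.
have E h : H w h -> avg (fun s => D w s * G s) = avg (fun s => D w (h * s)%g * G s).
  move=> hH; rewrite -(avg_perm _ (mulgI h)); apply: eq_avg => s.
  by rewrite Gi.
apply: (mulfI (lt0r_neq0 c0)).
rewrite -(sum_cst_H w) (eq_bigr _ E) -avg_sum mulr0.
rewrite -[RHS](avg_cst (card_perm_gt0 n)); apply: eq_avg => s.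
by rewrite -mulr_suml sum_D mul0r.
Qed.

Lemma avg_D w : avg (D w) = 0.
Proof.
rewrite -[RHS](@D_orth w (fun _ => 1)) //.
by apply: eq_avg => s; rewrite mulr1.
Qed.

(** [D w / c] is an orthogonal projection of [X], so its inner product with [X] is its own mean
    square. *)
Lemma avg_XD w : avg (fun s => X s * D w s) = avg (fun s => D w s ^+ 2) / c.
Proof.
have cn0 := lt0r_neq0 (c_gt0 w).
apply: (mulIf cn0); rewrite mulfVK //.
have E s : D w s ^+ 2 = c * (X s * D w s) - D w s * \sum_(h | H w h) X (h * s)%g.
  by rewrite expr2 {2}D_alt; ring.
rewrite (eq_avg E) avgB avgZ D_orth ?subr0 1?mulrC // => h s hH.
exact: sum_orbit_inv.
Qed.

(* The [D w] are orthogonal, and [c * Cov(X, D w)] is the mean square of [D w]. *)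
Lemma block_variance : N%:R * d / c ^+ 2 <= avg (fun s => (X s - avg X) ^+ 2).
Proof.
pose T s := \sum_w D w s.
pose B := \sum_w avg (fun s => D w s ^+ 2).
have V0 : 0 <= avg (fun s => (X s - avg X) ^+ 2) by apply: avg_ge0 => s; exact: sqr_ge0.
have NB : N%:R * d <= B.
  rewrite mulr_natl -[N in d *+ N]card_ord -sumr_const; apply: ler_sum => w _.
  exact: Dd.
apply: (@le_trans _ _ (B / c ^+ 2)); first by rewrite ler_wpM2r ?invr_ge0 ?sqr_ge0.
have [N0|] := posnP N.
  rewrite /B big1 ?mul0r // => w _.
  by case: w => [x xN]; exfalso; rewrite N0 in xN.
move=> N0; have c0 := c_gt0 (Ordinal N0).
have B0 : 0 <= B by apply: sumr_ge0 => w _; apply: avg_ge0 => s; exact: sqr_ge0.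
have [->|Bn0] := eqVneq B 0; first by rewrite mul0r.
have Bp : 0 < B by rewrite lt_def Bn0.
have T2 : avg (fun s => T s ^+ 2) = B.
  have E s : T s ^+ 2 = \sum_w \sum_w' D w s * D w' s by rewrite expr2 big_distrlr.
  rewrite (eq_avg E) avg_sum; apply: eq_bigr => w _.
  have off w' : w' != w -> avg (fun s => D w s * D w' s) = 0.
    move=> ww'; apply: D_orth => h s hH; apply: D_inv hH.
    by rewrite eq_sym.
  rewrite avg_sum (bigD1 w) //= (eq_bigr _ off) sumr_const mul0rn addr0.
  by apply: eq_avg => s; rewrite expr2.
have XT : avg (fun s => (X s - avg X) * T s) = B / c.
  rewrite /B mulr_suml.
  have E s : (X s - avg X) * T s = \sum_w (X s * D w s - avg X * D w s).
    by rewrite mulr_sumr; apply: eq_bigr => w _; rewrite mulrBl.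
  rewrite (eq_avg E) avg_sum; apply: eq_bigr => w _.
  by rewrite avgB avgZ avg_D mulr0 subr0 avg_XD.
have := avg_cauchy_schwarz (fun s => X s - avg X) T.
rewrite XT T2 -ler_pdivrMr //; apply: le_trans.
rewrite le_eqVlt; apply/orP; left; apply/eqP; field.
by rewrite Bn0 gt_eqF.
Qed.

End BlockVariance.

(** * Variance with a single block *)

Section VarConsecutive.
Variables (R : realType) (k : nat) (pi : 'S_k) (A : {set 'I_k.-1}).
Hypothesis k2 : (2 <= k)%N.
Hypothesis j1 : #|starts A| = 1%N.
Local Notation bs := (@bs k A).
(** A window consists of three stretches of length [k]. Only the middle one is permuted, and an
    occurrence, being [k] consecutive positions, cannot both meet the middle and leave the
    window. *)
Let L := (3 * k)%N.

Lemma k_gt0 : (0 < k)%N. Proof. by lia. Qed.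
Let r0 : 'I_k := Ordinal k_gt0.

Lemma bs_r0 r : bs r = r0.
Proof.
have /eqP/cards1P[x xE] := j1.
have h t : bs t = x by have := bs_in A t; rewrite xE inE => /eqP.
by rewrite h -(h r0); apply: val_inj.
Qed.

Lemma L_gt0 : (0 < L)%N. Proof. by rewrite /L; have := k_gt0; lia. Qed.

Section FixN.
Variable n : nat.
Local Notation valid := (@valid k n A).
Local Notation ind i s := ((matches pi s i)%:R : R).
Let N := (n %/ L)%N.
Let X (s : 'S_n) : R := occ_count R pi A s.

Lemma valid_consecutive i r : valid i -> i r = (i r0 + r)%N :> nat.
Proof. by move=> vi; rewrite (valid_bs r vi) bs_r0 /= subn0. Qed.

Lemma window_lt (w : 'I_N) (x : nat) : (x < L)%N -> (w * L + x < n)%N.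
Proof.
move=> xL; have := leq_divM n L; have := ltn_ord w; rewrite -/N => wN NL.
have : (w.+1 * L <= N * L)%N by rewrite leq_mul2r wN orbT.
by rewrite mulSn; lia.
Qed.

Lemma middle_lt (r : 'I_k) : (k + r < L)%N.
Proof. by rewrite /L; have := ltn_ord r; lia. Qed.

Definition middle (w : 'I_N) : {ffun 'I_k -> 'I_n} :=
  [ffun r => Ordinal (window_lt w (middle_lt r))].

Definition window (w : 'I_N) : {set 'I_n} := [set x : 'I_n | (x %/ L)%N == w]%SET.

Lemma middleE w r : middle w r = (w * L + (k + r))%N :> nat.
Proof. by rewrite ffunE. Qed.

Lemma in_window (w : 'I_N) (x : 'I_n) (y : nat) : (y < L)%N -> x = (w * L + y)%N :> nat ->
  x \in window w.
Proof. by move=> yL xE; rewrite inE xE divnMDl ?L_gt0 // divn_small ?addn0. Qed.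

Lemma valid_middle w : valid (middle w).
Proof.
apply/andP; split.
  apply/forallP => r; apply/forallP => t; apply/implyP => rt.
  by rewrite !middleE !ltn_add2l.
apply/forallP => a; apply/implyP => aA; apply/forallP => r; apply/forallP => t.
apply/implyP => /andP[/eqP ra /eqP ta]; rewrite !middleE ra ta.
by rewrite !addnS.
Qed.

Lemma middle_window w : imset_of (middle w) \subset window w.
Proof.
apply/fintype.subsetP => _ /imsetP[r _ ->].
exact: in_window (middle_lt r) (middleE w r).
Qed.

Lemma window_disj w w' x : x \in window w -> x \in window w' -> w = w'.
Proof. by rewrite !inE => /eqP a /eqP b; apply: val_inj; rewrite /= -a b. Qed.

Lemma valid_window w i : valid i -> ~~ [disjoint imset_of i & imset_of (middle w)]%B ->
  imset_of i \subset window w.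
Proof.
move=> vi /pred0Pn[_ /andP[/imsetP[r _ ->] /imsetP[t _ rt]]].
have irt : i r = (w * L + (k + t))%N :> nat by rewrite rt middleE.
apply/fintype.subsetP => _ /imsetP[r' _ ->].
have e1 := valid_consecutive r vi; have e2 := valid_consecutive r' vi.
have h1 := ltn_ord r; have h2 := ltn_ord r'; have h3 := ltn_ord t.
apply: (@in_window w _ (k + t + r' - r)); first by rewrite /L; lia.
by rewrite e2; lia.
Qed.

Let D (w : 'I_N) (s : 'S_n) : R :=
  \sum_(h | perm_on (imset_of (middle w)) h) (X s - X (h * s)%g).

(** Vectors disjoint from the middle stretch cancel in [X s - X (h * s)], and all others lie inside
    the window. *)
Lemma D_order w : order_on (window w) (D w).
Proof.
move=> s s' ss'; rewrite /D; apply: eq_bigr => h hU.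
rewrite /X !occ_countE -!sumrB; apply: eq_bigr => i vi.
have hW : perm_on (window w) h.
  by apply: fintype.subset_trans hU _; exact: middle_window.
have [dis|ndis] := boolP [disjoint imset_of i & imset_of (middle w)]%B.
  have fixd (t : 'S_n) : ind i (h * t)%g = ind i t.
    apply: (@matches_order R k n pi i) => x y xi yi.
    by rewrite !permM !(out_perm hU) // ?(disjointFr dis).
  by rewrite (fixd s) (fixd s') !subrr.
have iW := valid_window vi ndis.
have mo := order_onS iW (@matches_order R k n pi i).
congr (_ - _); first exact: mo.
by apply: mo => x y xW yW; rewrite !permM ss' ?(perm_closed _ hW).
Qed.

Lemma D_invariant w w' : w' != w -> forall h s,
  perm_on (imset_of (middle w')) h -> D w (h * s)%g = D w s.
Proof.
move=> ww' h s hU; apply: D_order => x y xW yW.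
have out z : z \in window w -> h z = z.
  move=> zW; apply: (out_perm hU); apply: contraNN ww' => zU.
  apply/eqP; apply: (window_disj (x := z)) zW.
  exact: (fintype.subsetP (middle_window w')).
by rewrite !permM !out.
Qed.

(** A monotone permutation avoids the pattern: the decreasing one if [pi] begins with an ascent, the
    increasing one otherwise. *)
Lemma exists_no_occ : exists s : 'S_n, X s = 0.
Proof.
have k1 : (1 < k)%N by [].
pose r1 : 'I_k := Ordinal k1.
suff [s sP] : exists s : 'S_n, forall i, valid i -> ~~ matches pi s i.
  exists s; rewrite /X occ_countE big1 // => i vi.
  by rewrite (negbTE (sP i vi)).
case: (ltnP (pi r0) (pi r1)) => [lt01|ge01].
  exists (perm (@rev_ord_inj n)) => i vi; apply/negP => /forallP/(_ r0)/forallP/(_ r1).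
  rewrite lt01 !permE /= => /eqP/esym; have := @valid_lt _ _ _ i r0 r1 vi erefl.
  by have := ltn_ord (i r1); lia.
exists 1%g => i vi; apply/negP => /forallP/(_ r0)/forallP/(_ r1).
by rewrite !perm1 (@valid_lt _ _ _ i r0 r1 vi) // ltnNge ge01.
Qed.

(** From a permutation without occurrences, some rearrangement of the middle stretch creates one, so
    [D w] is at most -1 there. The relative order on a window of at most [L] positions recurs with
    probability at least [1 / L!]. *)
Lemma D_ge w : (L`!)%:R^-1 <= avg (fun s => D w s ^+ 2).
Proof.
have [s0 X0] := exists_no_occ.
have [h0 h0U h0m] := exists_matching_from pi s0 (valid_middle w).
have Xge0 s : 0 <= X s by exact: ler0n.
have Xh0 : 1 <= X (h0 * s0)%g.
  rewrite /X occ_countE (bigD1 (middle w)) ?valid_middle //= h0m lerDl.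
  by apply: sumr_ge0 => i _; exact: ler0n.
have Ds0 : 1 <= D w s0 ^+ 2.
  have h : 1 <= - D w s0.
    rewrite /D -sumrN (bigD1 h0) //= X0 sub0r opprK.
    rewrite -[leLHS]addr0 lerD // sumr_ge0 // => h _.
    by rewrite sub0r opprK.
  by rewrite -sqrrN expr_ge1 // (le_trans ler01 h).
have ord : order_on (window w) (fun s => D w s ^+ 2).
  by move=> s s' ss'; rewrite (D_order ss').
apply: le_trans (avg_order_ge ord _ Ds0) => [|s]; last exact: sqr_ge0.
rewrite lef_pV2 ?posrE ?ltr0n ?fact_gt0 // ler_nat.
have cw : (#|window w| <= L)%N.
  pose f (x : 'I_n) : 'I_L := Ordinal (ltn_pmod x L_gt0).
  rewrite -[leqRHS]card_ord; apply: (@leq_card_in _ _ f) => x y.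
  rewrite !inE => /eqP xw /eqP yw /(congr1 val) /= xy.
  by apply: val_inj; rewrite /= (divn_eq x L) (divn_eq y L) xw yw xy.
elim: L cw => [|m IH]; first by rewrite leqn0 => /eqP ->.
rewrite leq_eqVlt => /orP[/eqP -> //|]; rewrite ltnS => /IH h.
by apply: leq_trans h _; rewrite factS leq_pmull.
Qed.

Lemma var_consecutive : N%:R * (L`!)%:R^-1 / (k`!)%:R ^+ 2 <= occ_var R n pi A.
Proof.
apply: (@block_variance R n N X (fun w => imset_of (middle w))).
- move=> w; congr (_%:R); rewrite -[in RHS](card_imset_of (valid_middle w)) -card_perm.
  by apply: eq_card => h; rewrite !inE.
- exact: D_invariant.
- exact: D_ge.
Qed.

End FixN.

Lemma var_ge_single : exists2 c : R, 0 < c & exists n1, forall n, (n1 <= n)%N ->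
  c * n%:R ^+ (2 * #|starts A| - 1) <= occ_var R n pi A.
Proof.
have L0 := L_gt0.
have LR : 0 < L%:R :> R by rewrite ltr0n.
exists ((2 * L%:R)^-1 * ((L`!)%:R^-1 / (k`!)%:R ^+ 2)).
  by rewrite !mulr_gt0 // invr_gt0 ?exprn_gt0 ?mulr_gt0 ?ltr0n ?fact_gt0.
exists L => n Ln; rewrite j1 expr1.
apply: le_trans (var_consecutive n).
rewrite -[leRHS]mulrA mulrAC; apply: ler_wpM2r.
  by rewrite mulr_ge0 ?invr_ge0 ?exprn_ge0.
rewrite mulrC ler_pdivrMr ?mulr_gt0 // mulrC -!natrM ler_nat.
by apply: divn_half; rewrite L0 Ln.
Qed.

End VarConsecutive.

(** * Assembly *)

Lemma two_mul_sub1 m : (0 < m)%N -> (2 * m - 1 = m.-1 * 2 + 1)%N.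
Proof. lia. Qed.

Section FiniteCLT.
Variables (R : realType) (k : nat) (pi : 'S_k) (A : {set 'I_k.-1}).
Hypothesis k2 : (2 <= k)%N.
Let j := #|starts A|.

Lemma starts_gt0 : (0 < j)%N.
Proof.
have k0 : (0 < k)%N by lia.
by apply/card_gt0P; exists (bs A (Ordinal k0)); exact: bs_in.
Qed.

Lemma occ_var_ge : exists2 c : R, 0 < c & exists n1, forall n, (n1 <= n)%N ->
  c * n%:R ^+ (2 * j - 1) <= occ_var R n pi A.
Proof.
have [j1|j1] := eqVneq j 1%N; first exact: var_ge_single.
by apply: var_ge_multi => //; have := starts_gt0; rewrite -/j; lia.
Qed.

Section FixN.
Variable n : nat.
Local Notation valid := (@valid k n A).
Local Notation ind i s := ((matches pi s i)%:R : R).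
Let X (s : 'S_n) : R := occ_count R pi A s.
Let P := [set i | valid i]%SET.
Let I := {i : {ffun 'I_k -> 'I_n} | i \in P}.
Let xi (i : I) (s : 'S_n) : R := ind (val i) s - avg (fun s => ind (val i) s).
Let S (i : I) := imset_of (val i).

Lemma sum_xi s : \sum_i xi i s = X s - avg X.
Proof.
have E t : X t = \sum_(i in P) ind i t.
  by rewrite /X occ_countE; apply: eq_bigl => i; rewrite inE.
rewrite (eq_avg E) avg_sum E -sumrB.
by rewrite (big_sub P (fun i => ind i s - avg (fun s => ind i s))).
Qed.

(** A union bound over the [k^2] pairs of indices at which the two vectors can share a position; one
    prescribed entry fixes its block and leaves [j - 1] blocks free. *)
Lemma card_neighbours (i : I) :
  (#|[pred i' | ~~ [disjoint S i & S i']]| <= k ^ 2 * n ^ j.-1)%N.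
Proof.
have cnt (r t : 'I_k) : (\sum_(i' : I) (val i' t == val i r) <= n ^ j.-1)%N.
  rewrite -(big_sub P (fun x : {ffun 'I_k -> 'I_n} => nat_of_bool (x t == val i r))).
  apply: leq_trans (card_valid_at A t (val i r)).
  rewrite -sum1_card [leqRHS](eq_bigl (fun x => (x \in P) && (x t == val i r))); last first.
    by move=> x; rewrite !inE.
  by rewrite [leqRHS]big_mkcondr; apply: leq_sum => x _; case: (_ == _).
apply: (@leq_trans (\sum_(i' : I) \sum_(r : 'I_k) \sum_(t : 'I_k) (val i' t == val i r))).
  rewrite -sum1_card big_mkcond; apply: leq_sum => i' _; rewrite inE.
  case: ifP => // /pred0Pn[_ /andP[/imsetP[r _ ->] /imsetP[t _ rt]]].
  by rewrite (bigD1 r) //= (bigD1 t) //= rt eqxx.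
rewrite exchange_big; under eq_bigr do rewrite exchange_big.
apply: (@leq_trans (\sum_(r : 'I_k) \sum_(t : 'I_k) n ^ j.-1)).
  by apply: leq_sum => r _; apply: leq_sum => t _; exact: cnt.
by rewrite !sum_nat_const !card_ord mulnA mulnn.
Qed.

Lemma finite_clt_bound t : 0 < occ_var R n pi A -> (0 < n)%N ->
  let sg := Num.sqrt (occ_var R n pi A) in
  let N : R := n%:R ^+ j in let D : R := k%:R ^+ 2 * n%:R ^+ j.-1 in
  `|avg (fun s => ((X s - avg X) / sg <= t)%R%:R) - normal_cdf t| <=
  20 * (N * D ^+ 2 / sg ^+ 3 + D / sg + Num.sqrt (16 * N * D ^+ 3) / sg ^+ 2).
Proof.
move=> V0 n0.
pose sg : R := Num.sqrt (occ_var R n pi A).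
pose N : R := n%:R ^+ j; pose D : R := k%:R ^+ 2 * n%:R ^+ j.-1.
rewrite /= -/sg -/N -/D.
have E s : ((X s - avg X) / sg <= t)%R%:R = ((\sum_i xi i s) / sg <= t)%R%:R :> R.
  by rewrite sum_xi.
rewrite (eq_avg E).
apply: (@dep_clt R n I xi S N D sg).
- move=> i s s' ss'; rewrite /xi; congr (_ - _).
  exact: (@matches_order R k n pi (val i)).
- by move=> i; rewrite avgB (avg_cst (card_perm_gt0 n)) subrr.
- move=> i s; rewrite ler_norml /xi.
  have a0 : 0 <= avg (fun s => ind (val i) s) by apply: avg_ge0 => u; exact: ler0n.
  have a1 : avg (fun s => ind (val i) s) <= 1.
    rewrite -[leRHS](avg_cst (card_perm_gt0 n)); apply: ler_avg => u.
    by rewrite lern1 leq_b1.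
  by case: (matches _ _ _); rewrite /=; lra.
- rewrite card_sig /N -natrX ler_nat; apply: leq_trans (card_valid n A).
  by apply: eq_leq; apply: eq_card => x; rewrite !inE.
- move=> i; rewrite /D -!natrX -natrM ler_nat.
  by apply: leq_trans (card_neighbours i); rewrite (eq_card (B := [pred i' | ~~ [disjoint S i & S i']])).
- by rewrite sqrtr_gt0.
- by apply: mulr_gt0; apply: exprn_gt0; rewrite ltr0n // ltnW.
- by rewrite exprn_gt0 ?ltr0n.
- by rewrite sqr_sqrtr ?(ltW V0) //; apply: eq_avg => s; rewrite sum_xi.
Qed.

End FixN.

Lemma finite_clt : exists2 C : R, 0 < C & exists n0, forall n t, (n0 <= n)%N ->
  `|avg (fun s : 'S_n => ((occ_count R pi A s - avg (occ_count R pi A (n := n))) /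
      Num.sqrt (occ_var R n pi A) <= t)%R%:R) - normal_cdf t| <= C / Num.sqrt n%:R.
Proof.
have [c c0 [n1 Hn1]] := occ_var_ge.
pose K : R := k%:R ^+ 2; pose a := Num.sqrt c.
have K0 : 0 < K by rewrite exprn_gt0 // ltr0n; lia.
have K1 : 1 <= K by rewrite exprn_ege1 // ler1n; lia.
have a0 : 0 < a by rewrite sqrtr_gt0.
exists (20 * (K ^+ 2 / a ^+ 3 + K / a + 4 * K ^+ 2 / a ^+ 2)).
  have K2 : 0 < K ^+ 2 by exact: exprn_gt0.
  have a2 : 0 < a ^+ 2 by exact: exprn_gt0.
  have a3 : 0 < a ^+ 3 by exact: exprn_gt0.
  apply: mulr_gt0 => //; apply: addr_gt0; first by apply: addr_gt0; apply: divr_gt0.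
  by apply: divr_gt0 => //; apply: mulr_gt0.
exists (maxn n1 1) => n t; rewrite geq_max => /andP[nn1 n0].
have nu0 : 0 < n%:R :> R by rewrite ltr0n.
have cV := Hn1 n nn1.
have V0 : 0 < occ_var R n pi A.
  by apply: lt_le_trans cV; apply: mulr_gt0 => //; apply: exprn_gt0.
have := finite_clt_bound t V0 n0; rewrite -/K /=.
set sg := Num.sqrt (occ_var _ _ _ _); set rn := Num.sqrt n%:R; set nu := n%:R.
(* In these terms [N = p rn^2], [D = K p] and [sg >= a p rn], so [p] cancels from each of the three
   errors and a factor [1 / rn] remains. *)
pose p : R := nu ^+ j.-1.
have p0 : 0 < p by rewrite exprn_gt0.
have rn0 : 0 < rn by rewrite sqrtr_gt0.
have rn2 : rn ^+ 2 = nu by rewrite sqr_sqrtr // ltW.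
have Np : nu ^+ j = p * rn ^+ 2.
  by rewrite /p rn2 -exprSr prednK // starts_gt0.
have sg0 : 0 < sg by rewrite sqrtr_gt0.
have sga : a * p * rn <= sg.
  have E : (a * p * rn) ^+ 2 = c * nu ^+ (2 * j - 1).
    rewrite (two_mul_sub1 starts_gt0) -/j.
    by rewrite exprD exprM expr1 -/p -rn2 !exprMn sqr_sqrtr ?mulrA // ltW.
  rewrite -(ger0_norm (x := a * p * rn)); last by rewrite !mulr_ge0 // ltW.
  by rewrite -sqrtr_sqr E; apply: ler_wsqrtr.
have s0 : 0 < a * p * rn by rewrite !mulr_gt0.
rewrite Np -/p => H; apply: le_trans H _.
move: p p0 Np sga s0 => p p0 Np sga s0.
have an0 : a != 0 by rewrite gt_eqF.
have pn0 : p != 0 by rewrite gt_eqF.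
have rnn0 : rn != 0 by rewrite gt_eqF.
rewrite -[leRHS]mulrA; apply: ler_wpM2l => //; rewrite [leRHS]mulrDl [X in _ <= X + _]mulrDl.
apply: lerD; first apply: lerD.
- apply: (@le_trans _ _ (p * rn ^+ 2 * (K * p) ^+ 2 / (a * p * rn) ^+ 3)).
    apply: ler_wpM2l; first by rewrite !mulr_ge0 ?exprn_ge0 ?mulr_ge0 // ltW.
    by rewrite lef_pV2 ?posrE ?exprn_gt0 // lerXn2r ?nnegrE ?(ltW s0) ?(ltW sg0).
  by rewrite le_eqVlt; apply/orP; left; apply/eqP; field; rewrite an0 pn0 rnn0.
- apply: (@le_trans _ _ (K * p / (a * p * rn))).
    apply: ler_wpM2l; first by rewrite mulr_ge0 // ltW.
    by rewrite lef_pV2 ?posrE.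
  by rewrite le_eqVlt; apply/orP; left; apply/eqP; field; rewrite an0 pn0 rnn0.
- apply: (@le_trans _ _ (4 * K ^+ 2 * p ^+ 2 * rn / (a * p * rn) ^+ 2)).
    rewrite ler_pM ?sqrtr_ge0 ?invr_ge0 ?sqr_ge0 //; last first.
      by rewrite lef_pV2 ?posrE ?exprn_gt0 // lerXn2r ?nnegrE ?(ltW s0) ?(ltW sg0).
    (* As [K >= 1], the factor [K^3] under the root may be raised to [K^4], which makes the radicand
       a perfect square. *)
    have B0 : 0 <= 4 * K ^+ 2 * p ^+ 2 * rn.
      by rewrite !mulr_ge0 ?exprn_ge0 // ltW.
    rewrite -(ger0_norm B0) -sqrtr_sqr ler_wsqrtr //.
    have -> : (4 * K ^+ 2 * p ^+ 2 * rn) ^+ 2 =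
       16 * (p * rn ^+ 2) * (K * p) ^+ 3 * K by ring.
    by rewrite ler_peMr // !mulr_ge0 ?exprn_ge0 ?mulr_ge0 // ltW.
  by rewrite le_eqVlt; apply/orP; left; apply/eqP; field; rewrite an0 pn0 rnn0.
Qed.

End FiniteCLT.

(** * From averages over permutations to random variables *)

Section Transfer.
Variables (R : realType) (n : nat) (d : measure_display) (T : measurableType d)
  (P : probability T R) (sigma : {RV P >-> 'S_n}).
Hypothesis unif : uniform_perm sigma.

Lemma measurable_perm_preimage (B : set 'S_n) : measurable (sigma @^-1` B).
Proof. by rewrite -[X in measurable X]setTI; exact: measurable_funPT. Qed.

(** The nonnegative case is enough: it is applied to the count, to its squared deviation and to an
    indicator. *)
Lemma integral_uniform_perm (F : 'S_n -> R) : (forall s, 0 <= F s) ->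
  (\int[P]_w (F (sigma w))%:E = (avg F)%:E)%E.
Proof.
move=> F0.
have E w : (F (sigma w))%:E =
    (\sum_(s : 'S_n) (F s)%:E * (\1_(sigma @^-1` [set s]) w)%:E)%E.
  rewrite (bigD1 (sigma w)) //= big1 ?adde0.
    by rewrite indicE mem_set // mule1.
  move=> s sw; rewrite indicE memNset ?mule0 //= => h.
  by rewrite h eqxx in sw.
rewrite (eq_integral (fun w => \sum_(s : 'S_n) (F s)%:E * (\1_(sigma @^-1` [set s]) w)%:E)%E); last first.
  by move=> w _; exact: E.
rewrite ge0_integral_sum //; last 2 first.
- by move=> s; apply: measurable_funeM; apply/measurable_EFinP;
     apply: measurable_indic; exact: measurable_perm_preimage.
- by move=> s w _; rewrite mule_ge0 // lee_fin.
rewrite (eq_bigr (fun s => (F s * (n`!)%:R^-1)%:E)); last first.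
  move=> s _; rewrite ge0_integralZl_EFin //; last first.
    apply/measurable_EFinP; apply: measurable_indic.
    exact: measurable_perm_preimage.
  rewrite integral_indic //; last exact: measurable_perm_preimage.
  by rewrite setIT EFinM -(unif s).
by rewrite sumEFin -mulr_suml /avg card_Sn.
Qed.

Variables (k : nat) (pi : 'S_k) (A : {set 'I_k.-1}).
Local Notation X := (occ_rv pi A sigma).
Local Notation m := (avg (occ_count R pi A (n := n))).

Lemma fine_expectation_occ : fine 'E_P[X] = m.
Proof.
by rewrite expectation_def (integral_uniform_perm (F := occ_count R pi A)).
Qed.

Lemma fine_variance_occ : fine 'V_P[X] = occ_var R n pi A.
Proof.
rewrite /variance unlock fine_expectation_occ unlock.
rewrite (integral_uniform_perm (F := fun s => (occ_count R pi A s - m) * (occ_count R pi A s - m))) /=.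
  by rewrite /occ_var; apply: eq_avg => s; rewrite expr2.
by move=> s; rewrite -expr2 sqr_ge0.
Qed.

Lemma cdf_standardized_occ t : cdf (standardized_rv X) t =
  (avg (fun s : 'S_n => ((occ_count R pi A s - m) /
      Num.sqrt (occ_var R n pi A) <= t)%R%:R))%:E.
Proof.
set F := fun s : 'S_n => _.
rewrite -[RHS]integral_uniform_perm; last by move=> s; exact: ler0n.
pose B := [set s : 'S_n | (occ_count R pi A s - m) / Num.sqrt (occ_var R n pi A) <= t].
have -> : cdf (standardized_rv X) t = P (sigma @^-1` B).
  rewrite /cdf /distribution /pushforward /=; congr (P _).
  apply/seteqP; split => w /=; rewrite in_itv /= /standardize /B /=
    fine_expectation_occ fine_variance_occ //.
rewrite -[B in LHS]setIT preimage_setI preimage_setT.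
rewrite -integral_indic //; last exact: measurable_perm_preimage.
apply: eq_integral => w _; rewrite indicE /F /B /preimage /=.
by congr ((nat_of_bool _)%:R%:E); apply/idP/idP; rewrite inE.
Qed.

End Transfer.

Theorem theorem3p1 (R : realType) (k : nat) (hk : (2 <= k)%N)
    (pi : 'S_k) (A : {set 'I_k.-1}) :
  exists (C : R) (n0 : nat), 0 < C /\
    forall (d : nat -> measure_display) (T : forall n, measurableType (d n))
      (P : forall n, probability (T n) R)
      (sigma : forall n, {RV (P n) >-> 'S_n})
      (d' : measure_display) (T' : measurableType d') (P' : probability T' R)
      (Z : {RV P' >-> R}),
    (forall n, (k <= n)%N -> uniform_perm (sigma n)) ->
    standard_normal Z ->
    (forall n, (k <= n)%N -> (n0 <= n)%N ->
       (kolmogorov_dist (standardized_rv (occ_rv pi A (sigma n))) Z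
        <= (C * n%:R `^ (- 2^-1))%:E)%E) /\
    cvg_in_distribution
      (fun n => standardized_rv (occ_rv pi A (sigma n))) Z.
Proof.
(* The constants come from a statement about finite averages, so they are fixed before any
   probability space is chosen. *)
have [C C0 [n0 H]] := @finite_clt R k pi A hk.
exists C, n0; split=> // d T P sigma d' T' P' Z unif normZ.
have cdfZ t : cdf Z t = (normal_cdf t)%:E.
  by rewrite -normal_probE; exact: normZ.
split.
  move=> n kn n0n; apply: ge_ereal_sup => _ [t _ <-].
  rewrite cdfZ (cdf_standardized_occ (unif n kn)) -EFinB abse_EFin lee_fin.
  by rewrite powRN powR12_sqrt //; exact: H.
move=> t _; rewrite cdfZ; apply/fine_cvgP; split.
  near=> n; rewrite (cdf_standardized_occ (unif n _)) //.
  by near: n; exact: nbhs_infty_ge.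
apply/cvgrPdist_le => e e0; near=> n.
have kn : (k <= n)%N by near: n; exact: nbhs_infty_ge.
have n0n : (n0 <= n)%N by near: n; exact: nbhs_infty_ge.
(* From this point on [C / sqrt n <= e]. *)
have en : (C / e) ^+ 2 <= n%:R by near: n; exact: nbhs_infty_ger.
rewrite /= (cdf_standardized_occ (unif n kn)) /= distrC.
apply: le_trans (H n t n0n) _.
have s0 : 0 < Num.sqrt n%:R :> R by rewrite sqrtr_gt0 ltr0n; lia.
rewrite ler_pdivrMr // mulrC -ler_pdivrMr //.
rewrite -(ger0_norm (x := C / e)) ?divr_ge0 ?(ltW C0) ?(ltW e0) //.
by rewrite -sqrtr_sqr ler_wsqrtr.
Unshelve. all: by end_near.
Qed.
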